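(* Let $G=G_1\times\cdots\times G_n$ be a product of non-trivial faithful finite groups and let $p$ be a prime. (1) If $p$ is coprime to $|Z(G)|$, then $\operatorname{covdim}(G\times\mathbb{Z}/p)=\operatorname{covdim} G$. (2) If $p$ divides $|Z(G_i)|$ for all $i$, then $\operatorname{covdim}(G\times(\mathbb{Z}/p)^m)=\operatorname{covdim} G+m$ for every integer $m\geq 1$. In particular, if $H$ is a non-trivial faithful finite group and $m\geq 1$, then $\operatorname{covdim}(H\times(\mathbb{Z}/p)^m)=\operatorname{covdim} H+m$ if $p$ divides $|Z(H)|$, and $\operatorname{covdim}(H\times(\mathbb{Z}/p)^m)=\operatorname{covdim} H+(m-1)$ otherwise.
   Context: The base field is $\mathbb{C}$; all modules are finite dimensional complex. A finite group is called faithful if it admits a faithful irreducible (complex) representation. $Z(G)$ is the center of $G$. A covariant of a finite group $G$ is a $G$-equivariant morphism (polynomial map) $\phi\colon V\to W$ of $G$-modules; $\dim\phi:=\dim\overline{\phi(V)}$; $\phi$ is faithful if $G$ acts faithfully on $\phi(V)$. The covariant dimension $\operatorname{covdim} G$ is the minimum of $\dim\phi$ over all faithful covariants of $G$. *)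

(* Defs.v *)
From mathcomp Require Import all_boot all_order all_algebra.
From mathcomp Require Import all_fingroup all_solvable all_character.
From mathcomp Require Import boolp classical_sets reals complex mpoly.

Set Implicit Arguments.
Unset Strict Implicit.
Unset Printing Implicit Defensive.

Import GRing.Theory.
Local Open Scope classical_set_scope.
Local Open Scope ring_scope.

Section ZariskiTopology.
Variables (F : fieldType) (n : nat).
Implicit Types (X A B : set 'rV[F]_n).

Definition mpoly_at (p : {mpoly F[n]}) (v : 'rV[F]_n) : F := p.@[fun i => v 0 i].

Definition zero_locus (S : set {mpoly F[n]}) : set 'rV[F]_n :=
  [set v | forall p, S p -> mpoly_at p v = 0].

Definition zariski_closed X := exists S, X = zero_locus S.

Definition zariski_closure X : set 'rV[F]_n :=
  [set v | forall A, zariski_closed A -> X `<=` A -> A v].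

(* For X closed, irreducibility of X as a topological space. *)
Definition zariski_irreducible X :=
  X !=set0 /\
  forall A B, zariski_closed A -> zariski_closed B ->
    X `<=` A `|` B -> X `<=` A \/ X `<=` B.

(* Z 0 < Z 1 < ... < Z d, all irreducible closed subsets of X; the values of Z
   beyond d are irrelevant. *)
Definition irreducible_chain X (d : nat) (Z : nat -> set 'rV[F]_n) :=
  [/\ forall i, (i <= d)%N ->
        [/\ zariski_closed (Z i), zariski_irreducible (Z i) & Z i `<=` X]
    & forall i, (i < d)%N -> Z i `<` Z i.+1].

(* Krull dimension of a closed X: the supremum of the lengths of chains. *)
Definition has_zariski_dim X (d : nat) :=
  (exists Z, irreducible_chain X d Z) /\
  forall e Z, irreducible_chain X e Z -> (e <= d)%N.

End ZariskiTopology.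

Section Covariants.
Variables (F : fieldType) (gT : finGroupType) (G : {group gT}).

Definition is_polynomial_map n m (phi : 'rV[F]_n -> 'rV[F]_m) :=
  exists f : 'I_m -> {mpoly F[n]},
    forall v, phi v = \row_j mpoly_at (f j) v.

(* The module of a representation rV is 'rV_n with g acting by v |-> v *m rV g.
   This is a right action; the left action is v |-> v *m rV g^-1, and passing
   from one to the other changes neither equivariance nor faithfulness. *)
Definition covariant n m (rV : mx_representation F G n)
    (rW : mx_representation F G m) (phi : 'rV[F]_n -> 'rV[F]_m) :=
  is_polynomial_map phi /\
  forall g v, g \in G -> phi (v *m rV g) = phi v *m rW g.

Definition acts_faithfully_on m (rW : mx_representation F G m)
    (A : set 'rV[F]_m) :=
  forall g, g \in G -> (forall w, A w -> w *m rW g = w) -> g = 1%g.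

Definition has_faithful_covariant_of_dim (d : nat) :=
  exists n m (rV : mx_representation F G n) (rW : mx_representation F G m)
         (phi : 'rV[F]_n -> 'rV[F]_m),
    [/\ covariant rV rW phi,
        acts_faithfully_on rW (range phi)
      & has_zariski_dim (zariski_closure (range phi)) d].

Definition is_covdim (d : nat) :=
  has_faithful_covariant_of_dim d /\
  forall e, has_faithful_covariant_of_dim e -> (d <= e)%N.

(* The minimum always exists, the identity of the regular module being a
   faithful covariant, so the default value 0 is never used. *)
Definition covdim : nat := xget 0%N is_covdim.

Definition faithful_group :=
  exists n (rG : mx_representation F G n), mx_irreducible rG /\ mx_faithful rG.

End Covariants.

Arguments covdim F {gT} G.
Arguments faithful_group F {gT} G.

(* Main.v *)
(* By Jacobian arguments in characteristic 0, the closure of the image of a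
   polynomial map has dimension the generic rank of its Jacobian. Composing with
   covariants through points with trivial stabilizer, one may choose the source
   and the target of a minimal faithful covariant; replacing it by its lowest
   multihomogeneous part does not increase the dimension, and keeps it faithful
   when the target is a sum of irreducible modules.
   For (2), elements of order p in the centers force the matrix of multidegrees
   to be the identity mod p, hence of full rank, so each factor Z/p contributes
   one to the dimension. For (1), multiplying the components by suitable powers
   of an invariant of degree prime to p makes some degree prime to p without
   enlarging the image; then Z/p can act by scalars. *)

(* The factors Z/p are added one at a time, so (2) needs an invariant that survives a step: a
   faithful module cut into irreducible blocks, each with a group element acting as a fixed
   primitive p-th root of unity on it and trivially elsewhere. Adding Z/p adds a one-dimensional
   block with the same property. A factor costs at most one, through an extra coordinate on which
   Z/p acts by a character; the lower bound drops that coordinate again and must show that this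
   loses a dimension. Irreducibility makes lowest parts harmless. Equivariance forces one common
   degree for all coordinates of a block, and whatever then survives in the block generates it, so
   no group element starts to act trivially. If p does not divide |Z(H)|, the first Z/p is free by
   (1). Tensoring a faithful irreducible module of H with a character of Z/p gives a faithful module
   of H x Z/p with one block, to which (2) applies; hence m - 1. Non-triviality of G enters (1)
   because it excludes constant covariants: their degrees are 0, which no invariant can correct. *)
From HB Require Import structures.
Require Import Defs.
From mathcomp Require Import all_boot all_order all_algebra.
From mathcomp Require Import all_fingroup all_solvable all_character.
From mathcomp Require Import ring.
From mathcomp Require Import boolp classical_sets reals complex mpoly.

Set Implicit Arguments.
Unset Strict Implicit.
Unset Printing Implicit Defensive.

Import GRing.Theory Num.Theory.
Local Open Scope ring_scope.

(** * Evaluation and weighted degrees *)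

Section Evaluation.
Variables (F : fieldType) (n : nat).
Implicit Types (p q : {mpoly F[n]}) (v : 'rV[F]_n) (w : 'I_n -> nat).

Lemma mpoly_at0 v : mpoly_at 0 v = 0. Proof. exact: rmorph0. Qed.
Lemma mpoly_atC c v : mpoly_at c%:MP v = c. Proof. exact: mevalC. Qed.
Lemma mpoly_at1 v : mpoly_at 1 v = 1. Proof. exact: rmorph1. Qed.
Lemma mpoly_atD p q v : mpoly_at (p + q) v = mpoly_at p v + mpoly_at q v.
Proof. exact: rmorphD. Qed.
Lemma mpoly_atN p v : mpoly_at (- p) v = - mpoly_at p v.
Proof. exact: rmorphN. Qed.
Lemma mpoly_atB p q v : mpoly_at (p - q) v = mpoly_at p v - mpoly_at q v.
Proof. exact: rmorphB. Qed.
Lemma mpoly_atM p q v : mpoly_at (p * q) v = mpoly_at p v * mpoly_at q v.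
Proof. exact: rmorphM. Qed.
Lemma mpoly_atXn p k v : mpoly_at (p ^+ k) v = mpoly_at p v ^+ k.
Proof. exact: rmorphXn. Qed.
Lemma mpoly_atZ c p v : mpoly_at (c *: p) v = c * mpoly_at p v.
Proof. exact: mevalZ. Qed.
Lemma mpoly_atX i v : mpoly_at 'X_i v = v 0 i. Proof. exact: mevalXU. Qed.
Lemma mpoly_at_monom (m : 'X_{1..n}) v :
  mpoly_at 'X_[m] v = \prod_i v 0 i ^+ m i.
Proof. exact: mevalX. Qed.
Lemma mpoly_at_sum (I : Type) (r : seq I) P (f : I -> {mpoly F[n]}) v :
  mpoly_at (\sum_(i <- r | P i) f i) v = \sum_(i <- r | P i) mpoly_at (f i) v.
Proof. exact: rmorph_sum. Qed.
Lemma mpoly_at_prod (I : Type) (r : seq I) P (f : I -> {mpoly F[n]}) v :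
  mpoly_at (\prod_(i <- r | P i) f i) v = \prod_(i <- r | P i) mpoly_at (f i) v.
Proof. exact: rmorph_prod. Qed.

Lemma mpoly_at_mderivX (i j : 'I_n) v :
  mpoly_at ('X_i : {mpoly F[n]})^`M(j) v = (i == j)%:R.
Proof.
rewrite mderivX mnm1E; have [->|_] := eqVneq i j.
  by rewrite scale1r -{1}[U_(j)%MM]add0m addmK mpolyX0 mpoly_at1.
by rewrite scale0r mpoly_at0.
Qed.

Definition mpoly_atE := (mpoly_at0, mpoly_at1, mpoly_atC, mpoly_atD, mpoly_atN,
  mpoly_atM, mpoly_atXn, mpoly_atZ, mpoly_atX, mpoly_at_monom, mpoly_at_sum,
  mpoly_at_prod).

Lemma mpoly_ring_ind (P : {mpoly F[n]} -> Prop) :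
    (forall c, P c%:MP) -> (forall i, P 'X_i) ->
    (forall p q, P p -> P q -> P (p + q)) ->
    (forall p q, P p -> P q -> P (p * q)) ->
  forall p, P p.
Proof.
move=> PC PX PD PM; apply: mpolyind => [|c m p _ _ Pp]; first exact: (PC 0).
apply: (PD) Pp; rewrite -mul_mpolyC; apply: (PM); first exact: PC.
rewrite mpolyXE_id; elim/big_rec: _ => [|i q _ Pq]; first exact: (PC 1).
apply: (PM) Pq; elim: (m i) => [|k IHk]; first exact: (PC 1).
by rewrite exprS; apply: (PM).
Qed.

(** Three kinds of weights occur: the constant 1 for the total degree, the indicator of a block for
    the degree in its variables, and the indicator of one variable. *)
Definition wdeg w (m : 'X_{1..n}) := (\sum_i m i * w i)%N.

Lemma wdeg0 w : wdeg w 0%MM = 0%N.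
Proof. by rewrite /wdeg big1 // => i _; rewrite mnm0E. Qed.

Lemma wdegD w : {morph wdeg w : m1 m2 / (m1 + m2)%MM >-> (m1 + m2)%N}.
Proof.
move=> m1 m2; rewrite /wdeg -big_split /=; apply: eq_bigr => i _.
by rewrite mnmDE mulnDl.
Qed.

HB.instance Definition _ w := isMeasure.Build n (wdeg w) (wdeg0 w) (@wdegD w).

Definition wpart w d p := pihomog (wdeg w) d p.
Definition whomog w d p := forall m, m \in msupp p -> wdeg w m = d.
Definition wsize w p := mmeasure (wdeg w) p.

Definition wscale w t v : 'rV[F]_n := \row_i (t ^+ w i * v 0 i).

Lemma mpoly_at_wscale w d p t v : whomog w d p ->
  mpoly_at p (wscale w t v) = t ^+ d * mpoly_at p v.
Proof.
move=> hp; rewrite [p in LHS]mpolyE [p in RHS]mpolyE !mpoly_atE mulr_sumr.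
rewrite big_seq [RHS]big_seq; apply: eq_bigr => m /hp <-.
rewrite !mpoly_atE mulrCA; congr (_ * _); rewrite /wdeg -prodrXr.
rewrite -big_split /=; apply: eq_bigr => i _.
by rewrite mxE exprMn -exprM mulnC.
Qed.

Lemma whomog_wpart w d p : whomog w d (wpart w d p).
Proof. exact/dhomogP/pihomogP. Qed.

Lemma wpart_sum w k p : (wsize w p <= k)%N -> p = \sum_(d < k) wpart w d p.
Proof. exact: pihomog_partitionE. Qed.

Lemma mcoeff_wpart w d p m :
  (wpart w d p)@_m = if wdeg w m == d then p@_m else 0.
Proof.
rewrite /wpart pihomogE raddf_sum /=; case: ifP => md; last first.
  rewrite big1 // => m' /eqP m'd; rewrite mcoeffZ mcoeffX.
  case: eqP => [e|_]; last by rewrite mulr0.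
  by rewrite -e m'd eqxx in md.
rewrite [in RHS](mpolyE p) raddf_sum /= big_mkcond; apply: eq_bigr => m' _.
rewrite mcoeffZ mcoeffX; case: ifP => // m'd.
case: eqP => [e|_]; last by rewrite mulr0.
by rewrite e md in m'd.
Qed.

Lemma msupp_wpart w d p m : m \in msupp (wpart w d p) -> m \in msupp p.
Proof.
by rewrite !mcoeff_msupp mcoeff_wpart; case: ifP => // _; rewrite eqxx.
Qed.

Lemma mpoly_at_wscale_sum w k p t v : (wsize w p <= k)%N ->
  mpoly_at p (wscale w t v) = \sum_(d < k) t ^+ d * mpoly_at (wpart w d p) v.
Proof.
move=> pk; rewrite [p in LHS](wpart_sum pk) mpoly_at_sum; apply: eq_bigr => d _.
by apply: mpoly_at_wscale; apply: whomog_wpart.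
Qed.

End Evaluation.

(** * Polynomial identities in characteristic 0 *)

Section CharZero.
Variable F : numFieldType.

Lemma poly_eq0_nonzero (p : {poly F}) :
  (forall t, t != 0 -> p.[t] = 0) -> p = 0.
Proof.
move=> p0; apply/eqP; case: (eqVneq p 0) => // pn0.
(* In characteristic 0 the values 1, ..., [size p] are distinct and nonzero: too many roots. *)
have := max_poly_roots (rs := [seq i.+1%:R | i <- iota 0 (size p)]) pn0.
rewrite size_map size_iota ltnn => /(_ _ _)-> //.
  by apply/allP => _ /mapP[i _ ->]; rewrite rootE p0 // pnatr_eq0.
rewrite map_inj_uniq ?iota_uniq // => i j /eqP.
by rewrite eqr_nat => /eqP[].
Qed.

(** The way to read an identity at all dilates of a point degree by degree. *)
Lemma sum_exp_eq0 k (c : nat -> F) :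
    (forall t, t != 0 -> \sum_(d < k) t ^+ d * c d = 0) ->
  forall d, (d < k)%N -> c d = 0.
Proof.
move=> c0 d dk; pose P : {poly F} := \poly_(e < k) c e.
suff /(congr1 (fun q : {poly F} => q`_d)) : P = 0 by rewrite coef_poly dk coef0.
apply: poly_eq0_nonzero => t t0; rewrite horner_poly -[RHS](c0 t t0).
by apply: eq_bigr => e _; rewrite mulrC.
Qed.

Lemma mpoly_wpart_vanish n (w : 'I_n -> nat) (p : {mpoly F[n]}) v :
  (forall t, t != 0 -> mpoly_at p (wscale w t v) = 0) ->
  forall d, mpoly_at (wpart w d p) v = 0.
Proof.
move=> p0 d; pose k := maxn (wsize w p) d.+1.
apply: (@sum_exp_eq0 k (fun d => mpoly_at (wpart w d p) v)) => [t t0|].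
  by rewrite -(@mpoly_at_wscale_sum _ _ w k) ?leq_maxl ?p0.
by rewrite leq_max leqnn orbT.
Qed.

(** Induction on the number of monomials. A single monomial is detected at the all-ones point; if
    two monomials differ in the exponent of some variable, the part of a fixed degree in that
    variable still vanishes everywhere and has fewer monomials. *)
Lemma mpoly_at_inj0 n (p : {mpoly F[n]}) : (forall v, mpoly_at p v = 0) -> p = 0.
Proof.
move=> p0; apply/eqP; apply: contraT => pn0.
have [k] := ubnP (size (msupp p)); elim: k => // k IHk in p p0 pn0 *.
rewrite ltnS => pk; have mp := mlead_supp pn0; set m := mlead p in mp.
case: (boolP (all (pred1 m) (msupp p))) => [/allP am | /allPn[m' m'p m'm]].
  have := p0 (const_mx 1); rewrite (mpolyE p) mpoly_at_sum.
  rewrite (bigD1_seq m) ?msupp_uniq //= big1_seq => [|m1 /andP[nm /am /eqP e]].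
    rewrite addr0 !mpoly_atE big1 => [/eqP|i _]; last by rewrite mxE expr1n.
    by rewrite mulr1 mcoeff_eq0 mp.
  by rewrite e eqxx in nm.
have [i mi] : exists i, m' i != m i.
  by apply/existsP; apply: contraNT m'm => /existsPn e; apply/eqP/mnmP => i;
     apply/eqP; have := e i; rewrite negbK.
pose w j := nat_of_bool (j == i).
have wE m1 : wdeg w m1 = m1 i.
  rewrite /wdeg (bigD1 i) //= /w eqxx muln1 big1 ?addn0 // => j /negPf->.
  by rewrite muln0.
apply: (IHk (wpart w (m i) p)) => [v||].
- by apply: mpoly_wpart_vanish => t _; apply: p0.
- by apply/eqP => /(congr1 (mcoeff m)) /eqP;
     rewrite mcoeff_wpart wE eqxx mcoeff0 mcoeff_eq0 mp.
apply: leq_trans pk; have p_gt0 : (0 < size (msupp p))%N by case: (msupp p) m'p.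
rewrite -(prednK p_gt0) -(size_rem m'p) ltnS.
apply: uniq_leq_size => [|m1 m1p]; first exact: msupp_uniq.
rewrite (rem_filter _ (msupp_uniq p)) mem_filter /= (msupp_wpart m1p) andbT.
by apply: contraNneq mi => <-; rewrite -wE; apply/eqP; apply: whomog_wpart m1p.
Qed.

Lemma mpoly_at_neq0 n (p : {mpoly F[n]}) : p != 0 -> exists v, mpoly_at p v != 0.
Proof.
move=> pn0; apply: contrapT => nex; case/eqP: pn0; apply: mpoly_at_inj0 => v.
by apply/eqP; apply: contrapT => /negP pv; apply: nex; exists v.
Qed.

(** Finitely many nonempty open conditions can be met at once, since polynomials form a domain. *)
Lemma mpoly_generic n (I : finType) (P : pred I) (p : I -> {mpoly F[n]}) :
    (forall i, P i -> exists v, mpoly_at (p i) v != 0) ->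
  exists v, forall i, P i -> mpoly_at (p i) v != 0.
Proof.
move=> pn0; have: \prod_(i | P i) p i != 0.
  apply/prodf_neq0 => i /pn0[v]; apply: contraNneq => ->.
  by rewrite mpoly_at0.
case/mpoly_at_neq0 => v; rewrite mpoly_at_prod => /prodf_neq0 pv.
by exists v.
Qed.

End CharZero.

(** * Polynomial maps and their Jacobians *)

Section PolynomialMaps.
Variable F : fieldType.

Definition polymap n m (f : 'I_m -> {mpoly F[n]}) (v : 'rV[F]_n) : 'rV[F]_m :=
  \row_j mpoly_at (f j) v.

Definition psubst n m (f : 'I_m -> {mpoly F[n]}) (p : {mpoly F[m]}) :
  {mpoly F[n]} := p \mPo [tuple f j | j < m].

(** The transpose of the usual Jacobian: with row vectors the chain rule then reads from left to
    right. *)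
Definition jacobian n m (f : 'I_m -> {mpoly F[n]}) (v : 'rV[F]_n) : 'M_(n, m) :=
  \matrix_(i, j) mpoly_at (f j)^`M(i) v.

Section Psubst.
Variables (n m : nat) (f : 'I_m -> {mpoly F[n]}).
Implicit Types p q : {mpoly F[m]}.

Lemma psubst0 : psubst f 0 = 0. Proof. exact: rmorph0. Qed.
Lemma psubstC c : psubst f c%:MP = c%:MP. Proof. exact: comp_mpolyC. Qed.
Lemma psubstD p q : psubst f (p + q) = psubst f p + psubst f q.
Proof. exact: rmorphD. Qed.
Lemma psubstM p q : psubst f (p * q) = psubst f p * psubst f q.
Proof. exact: rmorphM. Qed.
Lemma psubstX i : psubst f 'X_i = f i.
Proof.
by rewrite /psubst comp_mpolyXU -tnth_nth tnth_mktuple.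
Qed.
Lemma psubst_sum (I : Type) (r : seq I) P (g : I -> {mpoly F[m]}) :
  psubst f (\sum_(i <- r | P i) g i) = \sum_(i <- r | P i) psubst f (g i).
Proof. exact: rmorph_sum. Qed.
Lemma psubst_monom c (e : 'X_{1..m}) :
  psubst f (c *: 'X_[e]) = c *: \prod_j f j ^+ e j.
Proof.
rewrite /psubst comp_mpolyZ comp_mpolyX; congr (_ *: _).
by apply: eq_bigr => j _; rewrite tnth_mktuple.
Qed.

Lemma mpoly_at_psubst p v : mpoly_at (psubst f p) v = mpoly_at p (polymap f v).
Proof.
rewrite /mpoly_at /psubst comp_mpoly_meval; apply: meval_eq => j.
by rewrite tnth_mktuple mxE.
Qed.

Lemma mderiv_psubst p i :
  (psubst f p)^`M(i) = \sum_j psubst f p^`M(j) * (f j)^`M(i).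
Proof.
elim/mpoly_ring_ind: p => [c|j|p q IHp IHq|p q IHp IHq].
- rewrite psubstC mderivC big1 // => j _.
  by rewrite mderivC psubst0 mul0r.
- rewrite psubstX (bigD1 j) //= big1 => [|k kj]; rewrite mderivX mnm1E.
    by rewrite eqxx scale1r -{1}[U_(j)%MM]add0m addmK mpolyX0 [psubst f 1]psubstC mul1r addr0.
  by rewrite eq_sym (negPf kj) scale0r psubst0 mul0r.
- rewrite psubstD mderivD IHp IHq -big_split; apply: eq_bigr => j _ /=.
  by rewrite mderivD psubstD mulrDl.
rewrite psubstM mderivM IHp IHq mulr_suml mulr_sumr -big_split /=.
apply: eq_bigr => j _; rewrite mderivM psubstD !psubstM mulrDl -!mulrA.
by congr (_ * _ + _); rewrite mulrC.
Qed.

Lemma eq_psubst g p : f =1 g -> psubst f p = psubst g p.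
Proof. by move=> fg; congr comp_mpoly; apply: eq_mktuple. Qed.

End Psubst.

Lemma psubst_comp n m k (f : 'I_m -> {mpoly F[n]}) (g : 'I_k -> {mpoly F[m]}) p :
  psubst f (psubst g p) = psubst (fun j => psubst f (g j)) p.
Proof.
elim/mpoly_ring_ind: p => [c|j|p q IHp IHq|p q IHp IHq].
- by rewrite !psubstC.
- by rewrite !psubstX.
- by rewrite !psubstD IHp IHq.
by rewrite !psubstM IHp IHq.
Qed.

Lemma psubst_id n (p : {mpoly F[n]}) : psubst (fun i => 'X_i) p = p.
Proof. exact: comp_mpoly_id. Qed.

Lemma jacobian_psubst n m k (f : 'I_m -> {mpoly F[n]}) (g : 'I_k -> {mpoly F[m]}) v :
  jacobian (fun j => psubst f (g j)) v = jacobian f v *m jacobian g (polymap f v).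
Proof.
apply/matrixP => i j; rewrite !mxE mderiv_psubst mpoly_at_sum.
by apply: eq_bigr => l _; rewrite mpoly_atM mpoly_at_psubst !mxE mulrC.
Qed.

Definition alg_indep n m (f : 'I_m -> {mpoly F[n]}) :=
  forall p, psubst f p = 0 -> p = 0.

Definition fcons T k (x : T) (f : 'I_k -> T) (i : 'I_k.+1) : T :=
  if unlift ord0 i is Some j then f j else x.

Lemma fcons0 T k (x : T) (f : 'I_k -> T) : fcons x f ord0 = x.
Proof. by rewrite /fcons unlift_none. Qed.

Lemma fconsS T k (x : T) (f : 'I_k -> T) j : fcons x f (lift ord0 j) = f j.
Proof. by rewrite /fcons liftK. Qed.

Lemma eq_psubst_free n k (f g : 'I_k.+1 -> {mpoly F[n]}) p :
    (forall j, f (lift ord0 j) = g (lift ord0 j)) ->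
    (forall e, e \in msupp p -> e ord0 = 0%N) ->
  psubst f p = psubst g p.
Proof.
move=> fg p0; rewrite (mpolyE p) !psubst_sum big_seq [RHS]big_seq.
apply: eq_bigr => e /p0 e0; rewrite !psubst_monom !big_ord_recl e0 !expr0.
by congr (_ *: (_ * _)); apply: eq_bigr => j _; rewrite fg.
Qed.

(** Setting the first variable to 0, and [mlift] in the other direction, relate relations among k+1
    elements to relations among k. *)
Definition mdrop k (p : {mpoly F[k.+1]}) : {mpoly F[k]} :=
  psubst (fcons 0 (fun j => 'X_j)) p.
Definition mlift k (p : {mpoly F[k]}) : {mpoly F[k.+1]} :=
  psubst (fun j => 'X_(lift ord0 j)) p.

Lemma psubst_mdrop n k (f : 'I_k -> {mpoly F[n]}) p :
  psubst f (mdrop p) = psubst (fcons 0 f) p.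
Proof.
rewrite psubst_comp; apply: eq_psubst => i.
by rewrite /fcons; case: unlift => [j|]; rewrite ?psubstX ?psubst0.
Qed.

Lemma mdropK_free k (p : {mpoly F[k.+1]}) :
  (forall e, e \in msupp p -> e ord0 = 0%N) -> mlift (mdrop p) = p.
Proof.
move=> p0; rewrite /mlift psubst_mdrop -[RHS]psubst_id.
by apply: eq_psubst_free p0 => j; rewrite fconsS.
Qed.

Lemma msize_psum_le n k (r : seq 'X_{1..n}) (P : pred 'X_{1..n})
    (c : 'X_{1..n} -> F) (g : 'X_{1..n} -> 'X_{1..n}) :
    (forall e, e \in r -> P e -> mdeg (g e) < k)%N ->
  (msize (\sum_(e <- r | P e) c e *: 'X_[g e] : {mpoly F[n]}) <= k)%N.
Proof.
move=> gk; apply: leq_trans (mmeasure_sum _ _ _ _) _.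
rewrite big_seq_cond; apply/bigmax_leqP_seq => e _ /andP[er Pe].
by apply: leq_trans (msizeZ_le _ _) _; rewrite msizeX gk.
Qed.

(** Division by the first variable; the bound on the quotient feeds the induction in
    [indep_on_fcons]. *)
Lemma mdrop_decomp k (p : {mpoly F[k.+1]}) :
  exists2 q, p = mlift (mdrop p) + 'X_ord0 * q & (msize q <= (msize p).-1)%N.
Proof.
pose p0 := \sum_(e <- msupp p | e ord0 == 0%N) p@_e *: 'X_[e].
pose q := \sum_(e <- msupp p | e ord0 != 0%N) p@_e *: 'X_[e - U_(ord0)].
have pE : p = p0 + 'X_ord0 * q.
  rewrite {1}(mpolyE p) (bigID (fun e => (e : 'X_{1..k.+1}) ord0 == 0%N)) /=.
  congr (_ + _); rewrite mulr_sumr; apply: eq_bigr => e e0.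
  rewrite -scalerAr -mpolyXD; congr (_ *: 'X_[_]).
  by rewrite addmC submK // lep1mP.
exists q.
  rewrite {1}pE; congr (_ + _); rewrite /mdrop pE psubstD psubstM psubstX.
  rewrite fcons0 mul0r addr0 mdropK_free // => e.
  have p0E : p0 = \sum_(e <- msupp p | e ord0 == 0%N) p@_e *: 'X_[e] by [].
  rewrite mcoeff_msupp p0E raddf_sum /=; apply: contraNeq => e0.
  rewrite big1 // => e' /eqP e'0; rewrite mcoeffZ mcoeffX.
  case: eqP => [e'e|_]; last by rewrite mulr0.
  by rewrite -e'e e'0 eqxx in e0.
apply: msize_psum_le => e ep e0; rewrite -ltnS prednK; last first.
  by rewrite lt0n; apply: contraTneq ep => /eqP; rewrite mmeasure_poly_eq0 => /eqP->;
     rewrite msupp0.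
apply: leq_trans (msize_mdeg_lt ep).
have -> : e = (e - U_(ord0) + U_(ord0))%MM by rewrite submK // lep1mP.
by rewrite addmK mdegD mdeg1 addn1.
Qed.

End PolynomialMaps.

(** * Algebraic independence and the Jacobian criterion *)

Section AlgebraicIndependence.
Variable F : numFieldType.

Lemma msize_mderiv n (p : {mpoly F[n]}) i : (msize p^`M(i) <= (msize p).-1)%N.
Proof.
rewrite [X in (X <= _)%N]mmeasureE; apply/bigmax_leqP_seq => e ep _.
have : (e + U_(i))%MM \in msupp p.
  move: ep; rewrite !mcoeff_msupp mcoeff_deriv.
  by apply: contraNneq => ->; rewrite mul0rn.
by move/msize_mdeg_lt; rewrite mdegD mdeg1 addn1; case: (msize p).
Qed.

Lemma mderiv_eq0_free n (p : {mpoly F[n]}) i :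
  p^`M(i) = 0 -> forall e, e \in msupp p -> e i = 0%N.
Proof.
move=> p0 e ep; apply/eqP; apply: contraTT ep => ei.
have eE : e = (e - U_(i) + U_(i))%MM by rewrite submK // lep1mP.
rewrite -mcoeff_eq0; have := congr1 (mcoeff (e - U_(i))) p0.
by rewrite mcoeff_deriv -eE mcoeff0 => /eqP; rewrite mulrn_eq0.
Qed.

Lemma mderiv_eq0_const n (p : {mpoly F[n]}) :
  (forall i, p^`M(i) = 0) -> p = (p@_0)%:MP.
Proof.
move=> p0; apply/mpolyP => e; rewrite mcoeffC; case: eqVneq => [->|e0].
  by rewrite mulr1.
rewrite mulr0; apply/eqP; rewrite mcoeff_eq0; apply: contra e0 => ep.
by apply/eqP/mnmP => i; rewrite mnm0E (mderiv_eq0_free (p0 i) ep).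
Qed.

Lemma mpoly_eq0_generic n (p q : {mpoly F[n]}) :
    q != 0 -> (forall v, mpoly_at q v != 0 -> mpoly_at p v = 0) ->
  p = 0.
Proof.
move=> q0 pq; have /eqP : q * p = 0.
  apply: mpoly_at_inj0 => v; rewrite mpoly_atM.
  by case: (eqVneq (mpoly_at q v) 0) => [->|/pq->]; rewrite ?mul0r ?mulr0.
by rewrite mulf_eq0 (negPf q0) => /eqP.
Qed.

(* A nonvanishing minor of e0 M is the specialization of a minor d of M. *)
Lemma rank_specialization (R : comNzRingType) (c : {rmorphism F -> R})
    (e0 : {rmorphism R -> F}) n m (M : 'M[R]_(n, m)) :
    cancel c e0 ->
  exists2 d, d != 0 & forall e : {rmorphism R -> F}, cancel c e -> e d != 0 ->
    (\rank (map_mx e0 M) <= \rank (map_mx e M))%N.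
Proof.
move=> ce0; set A := map_mx e0 M; set r := \rank A.
have /row_fullP[B BC] : row_full (col_base A) by apply: col_base_full.
have [C CB] : exists C, row_base A *m C = 1%:M.
  by apply/row_freeP; apply: row_base_free.
pose d := \det (map_mx c B *m M *m map_mx c C).
have dE (e : {rmorphism R -> F}) : cancel c e -> e d = \det (B *m map_mx e M *m C).
  move=> ce; rewrite -det_map_mx !map_mxM -!map_mx_comp.
  by congr (\det (_ *m _ *m _)); apply/matrixP => i j; rewrite mxE /= ce.
exists d.
  have BA : B *m map_mx e0 M = row_base A.
    by rewrite -[RHS]mul1mx -BC -mulmxA mulmx_base.
  apply: contraTneq (oner_neq0 F) => d0; rewrite negbK.
  by rewrite -(det1 F r) -CB -BA -dE // d0 rmorph0.
move=> e ce; rewrite dE // -unitfE -unitmxE => /mxrank_unit rD.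
rewrite -[X in (X <= _)%N]rD -mulmxA.
exact: leq_trans (mxrankM_maxr _ _) (mxrankM_maxl _ _).
Qed.

Lemma jacobian_rank_generic n m (f : 'I_m -> {mpoly F[n]}) v :
  exists2 q, q != 0 & forall u, mpoly_at q u != 0 ->
    (\rank (jacobian f v) <= \rank (jacobian f u))%N.
Proof.
pose M : 'M_(n, m) := \matrix_(i, j) (f j)^`M(i).
have JE u : jacobian f u = map_mx (meval (fun i => u 0 i)) M.
  by apply/matrixP => i j; rewrite !mxE.
have [q q0 qP] := @rank_specialization _ (@mpolyC n F)
  (meval (fun i => v 0 i)) _ _ M (mevalC _).
by exists q => // u qu; rewrite !JE; apply: qP => //; apply: mevalC.
Qed.

(* A relation of minimal degree stays a relation after differentiation, since
   the Jacobian has full rank at a generic point. *)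
Lemma jacobian_alg_indep n m (f : 'I_m -> {mpoly F[n]}) v :
  \rank (jacobian f v) = m -> alg_indep f.
Proof.
move=> rv; have [q q0 qP] := jacobian_rank_generic f v.
move=> p; have [k] := ubnP (msize p); elim: k p => // k IHk p pk pf.
have [-> // | p0] := eqVneq p 0.
have dp0 j : p^`M(j) = 0.
  apply: IHk.
    apply: leq_ltn_trans (msize_mderiv p j) _.
    by rewrite -ltnS prednK // lt0n mmeasure_poly_eq0.
  apply: mpoly_eq0_generic q0 _ => u /qP; rewrite rv => ru.
  have /row_fullP[B BJ] : row_full (jacobian f u).
    by rewrite /row_full eqn_leq rank_leq_col.
  (* By the chain rule the gradient [g] of the relation is killed by the Jacobian, which has a left
     inverse. *)
  pose g := \col_j mpoly_at (psubst f p^`M(j)) u.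
  suff /colP/(_ j) : g = 0 by rewrite !mxE.
  rewrite -[g]mul1mx -BJ -mulmxA; suff -> : jacobian f u *m g = 0.
    by rewrite mulmx0.
  apply/colP => i; rewrite !mxE.
  have := congr1 (fun r => mpoly_at r^`M(i) u) pf.
  rewrite /= mderiv_psubst mderiv0 mpoly_at0 mpoly_at_sum => dpf.
  by rewrite -[RHS]dpf; apply: eq_bigr => l _; rewrite !mxE mpoly_atM mulrC.
by move: pf; rewrite (mderiv_eq0_const dp0) psubstC => /eqP; rewrite mpolyC_eq0 => /eqP->.
Qed.

Lemma mdeg_mul_le n (p q : {mpoly F[n]}) a b :
    (forall c, c \in msupp p -> mdeg c <= a)%N ->
    (forall c, c \in msupp q -> mdeg c <= b)%N ->
  (forall c, c \in msupp (p * q) -> mdeg c <= a + b)%N.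
Proof.
move=> pa qb c /msuppM_le/allpairsP[[c1 c2] /= [c1p c2q ->]].
by rewrite mdegD leq_add ?pa ?qb.
Qed.

Lemma mdeg_prod_exp_le n m (f : 'I_m -> {mpoly F[n]}) (e : 'I_m -> nat) c d :
    c \in msupp (\prod_j f j ^+ e j) -> (forall j, msize (f j) <= d)%N ->
  (mdeg c <= \sum_j e j * d)%N.
Proof.
move=> cX fd; elim/big_rec2: _ c cX => [|j a p _ IH] c.
  by rewrite msupp1 inE => /eqP->; rewrite mdeg0.
apply: mdeg_mul_le IH c => {p} c; elim: (e j) c => [|k IHk] c.
  by rewrite expr0 msupp1 inE => /eqP->; rewrite mdeg0.
rewrite exprS mulSn; apply: mdeg_mul_le IHk c => c /msize_mdeg_lt/ltnW cf.
exact: leq_trans cf (fd j).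
Qed.

(* Linear algebra: there are N ^ m products of the f j with exponents < N, all
   in the span of the (N * (m * d)) ^ n monomials of exponents < N * (m * d). *)
Lemma alg_indep_leq n m (f : 'I_m -> {mpoly F[n]}) : alg_indep f -> (m <= n)%N.
Proof.
move=> indf; rewrite leqNgt; apply/negP => nm.
pose d := (\max_j msize (f j)).+1.
(* Chosen so that (N * (m * d)) ^ n < N ^ n.+1 <= N ^ m: the products outnumber the monomials. The
   successor in [d] keeps it positive. *)
pose N := ((m * d) ^ n).+1; pose M := (N * (m * d))%N.
pose I := {ffun 'I_m -> 'I_N}; pose J := {ffun 'I_n -> 'I_M}.
have m_gt0 : (0 < m)%N by case: (m) nm.
have IJ : (#|{: J}| < #|{: I}|)%N.
  rewrite !card_ffun !card_ord (@leq_trans (N ^ n.+1)) ?leq_pexp2l //.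
  by rewrite expnMn expnSr ltn_pmul2l // expn_gt0.
pose X (e : I) := \prod_j f j ^+ e j.
pose mI (e : I) : 'X_{1..m} := [multinom (e j : nat) | j < m].
pose mJ (e : J) : 'X_{1..n} := [multinom (e j : nat) | j < n].
pose A : 'M[F]_(#|{: I}|, #|{: J}|) :=
  \matrix_(a, b) (X (enum_val a))@_(mJ (enum_val b)).
have degX e c : c \in msupp (X e) -> (mdeg c < M)%N.
  move=> eX.
  apply: (@leq_ltn_trans (\sum_(j < m) (N.-1 * d))%N).
    apply: leq_trans (mdeg_prod_exp_le eX _ (d := d)) _ => [j|].
      by apply: leqW; apply: (@leq_bigmax _ (fun j => msize (f j))).
    by apply: leq_sum => j _; rewrite leq_mul2r -ltnS ltn_ord orbT.
  by rewrite sum_nat_const card_ord mulnCA ltn_pmul2r // muln_gt0 m_gt0.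
have : kermx A != 0.
  rewrite kermx_eq0 /row_free; apply: contraTN IJ => /eqP <-.
  by rewrite -leqNgt rank_leq_col.
(* A vector of the left kernel is a linear relation among the products, that is, a polynomial
   relation among the [f j]. *)
case/rowV0Pn => u /sub_kermxP uA u0.
pose p := \sum_a u 0 a *: 'X_[mI (enum_val a)].
have inj_mI : injective mI.
  by move=> e e' /mnmP ee'; apply/ffunP => j; apply/val_inj; have := ee' j; rewrite !mnmE.
have pE a : p@_(mI (enum_val a)) = u 0 a.
  rewrite raddf_sum (bigD1 a) //= mcoeffZ mcoeffX eqxx mulr1.
  rewrite big1 ?addr0 // => b ba; rewrite mcoeffZ mcoeffX.
  by rewrite (inj_eq inj_mI) (inj_eq enum_val_inj) (negPf ba) mulr0.
suff p0 : p = 0.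
  by case/eqP: u0; apply/rowP => a; rewrite [RHS]mxE -pE p0 mcoeff0.
apply: indf; apply/mpolyP => c; rewrite mcoeff0 psubst_sum raddf_sum /=.
have XE b : (psubst f (u 0 b *: 'X_[mI (enum_val b)]))@_c =
            u 0 b * (X (enum_val b))@_c.
  rewrite psubst_monom mcoeffZ; congr (_ * _@_c).
  by apply: eq_bigr => j _; rewrite mnmE.
under eq_bigr => b _ do rewrite XE.
case: (ltnP (mdeg c) M) => [cM|cM]; last first.
  rewrite big1 // => b _; rewrite memN_msupp_eq0 ?mulr0 //.
  by apply: contraL cM => /degX; rewrite -ltnNge.
have cM' j : (c j < M)%N.
  by apply: leq_ltn_trans cM; rewrite mdegE (bigD1 j) //= leq_addr.
pose e : J := [ffun j => Ordinal (cM' j)].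
have cE : c = mJ e by apply/mnmP => j; rewrite mnmE ffunE.
have /rowP/(_ (enum_rank e)) := uA; rewrite !mxE => uAe; rewrite -[RHS]uAe.
by apply: eq_bigr => b _; rewrite !mxE enum_rankK -cE.
Qed.

End AlgebraicIndependence.

(** * Generic rank of the Jacobian *)

Section GenericRank.
Variable F : numFieldType.

(** Take a relation and differentiate in the first variable. If the derivative is a nonzero
    relation, it is a smaller one to continue with; if it is the zero polynomial, the first variable
    does not occur (characteristic 0) and [f] would be dependent. *)
Lemma alg_dep_separable n k (f : 'I_k -> {mpoly F[n]}) (x : {mpoly F[n]}) :
    alg_indep f -> ~ alg_indep (fcons x f) ->
  exists p, psubst (fcons x f) p = 0 /\ psubst (fcons x f) p^`M(ord0) != 0.
Proof.
move=> indf dep; set g := fcons x f.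
have [p [p0 pg]] : exists p, p <> 0 /\ psubst g p = 0.
  apply: contrapT => H; apply: dep => p pg; apply: contrapT => p0; apply: H.
  by exists p.
have [s] := ubnP (msize p); elim: s p p0 pg => // s IHs p /eqP p0 pg ps.
have [dpg|] := eqVneq (psubst g p^`M(ord0)) 0; last by exists p.
have [dp0|/eqP dp0] := eqVneq p^`M(ord0) 0; last first.
  apply: IHs dp0 dpg _; apply: leq_ltn_trans (msize_mderiv p _) _.
  by rewrite -ltnS prednK // lt0n mmeasure_poly_eq0.
have pfree := mderiv_eq0_free dp0; case/eqP: p0.
suff d0 : mdrop p = 0 by rewrite -(mdropK_free pfree) d0 /mlift psubst0.
apply: indf; rewrite psubst_mdrop -[RHS]pg.
by apply: eq_psubst_free pfree => j; rewrite /g !fconsS.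
Qed.

Lemma rank_col_lift (K : fieldType) n k (A : 'M[K]_(n, k.+1)) :
  \rank A = k.+1 -> \rank (\matrix_(i, j) A i (lift ord0 j)) = k.
Proof.
move=> rA; have /row_fullP[B BA] : row_full A by rewrite /row_full rA.
apply/eqP; rewrite -[_ == _]/(row_full _); apply/row_fullP.
exists (\matrix_(i, j) B (lift ord0 i) j).
apply/matrixP => i j; have /matrixP/(_ (lift ord0 i) (lift ord0 j)) := BA.
rewrite !mxE (inj_eq lift_inj) => <-.
by apply: eq_bigr => l _; rewrite !mxE.
Qed.

(* If every variable x_j is algebraic over f, differentiating a relation
   between x_j and f expresses e_j through the columns of the Jacobian. *)
Lemma alg_indep_jacobian n k (f : 'I_k -> {mpoly F[n]}) :
  alg_indep f -> exists v, \rank (jacobian f v) = k.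
Proof.
have [s] := ubnP (n - k); elim: s k f => // s IHs k f ks indf.
have kn := alg_indep_leq indf.
(* An independent variable can be adjoined to [f], which lowers n - k; deleting its column from the
   resulting Jacobian leaves full column rank. *)
have [[j indj]|dep] := EM (exists j, alg_indep (fcons 'X_j f)).
  have kn' := alg_indep_leq indj.
  have [|v rv] := IHs _ _ _ indj.
    by rewrite subnS prednK ?subn_gt0.
  exists v; rewrite -[RHS](rank_col_lift rv); congr (\rank _).
  by apply/matrixP => i l; rewrite !mxE fconsS.
have /choice[P PP] : forall j : 'I_n, exists p,
    psubst (fcons 'X_j f) p = 0 /\ psubst (fcons 'X_j f) p^`M(ord0) != 0.
  by move=> j; apply: alg_dep_separable => // indj; apply: dep; exists j.
have [|v vP] := @mpoly_generic _ n 'I_n predT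
    (fun j => psubst (fcons 'X_j f) (P j)^`M(ord0)).
  by move=> j _; apply: mpoly_at_neq0; case: (PP j).
exists v; apply/eqP; rewrite eqn_leq rank_leq_col (leq_trans kn) //.
rewrite -mxrank_tr -[X in (X <= _)%N](mxrank1 F n); apply: mxrankS.
apply/row_subP => j; rewrite row1.
pose g l := mpoly_at (psubst (fcons 'X_j f) (P j)^`M(l)) v.
have g0 : g ord0 != 0 by apply: vP.
apply/submxP; exists (\row_l (- (g ord0)^-1 * g (lift ord0 l))).
apply/rowP => i; have [Pj _] := PP j.
have := congr1 (fun r => mpoly_at r^`M(i) v) Pj.
rewrite /= mderiv_psubst mderiv0 mpoly_at0 mpoly_at_sum big_ord_recl fcons0.
rewrite mpoly_atM -/(g _) => /eqP; rewrite addrC addr_eq0 => /eqP E.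
rewrite !mxE eqxx /=.
transitivity (- (g ord0)^-1 * \sum_l g (lift ord0 l) * mpoly_at (f l)^`M(i) v).
  suff -> : \sum_l g (lift ord0 l) * mpoly_at (f l)^`M(i) v = - (g ord0 * (i == j)%:R).
    by rewrite mulNr mulrN opprK mulKf // eq_sym.
  transitivity (\sum_(l < k) mpoly_at (psubst (fcons 'X_j f) (P j)^`M(lift ord0 l) *
      (fcons 'X_j f (lift ord0 l))^`M(i)) v).
    by apply: eq_bigr => l _; rewrite mpoly_atM fconsS.
  by rewrite E mpoly_at_mderivX eq_sym.
rewrite mulr_sumr; apply: eq_bigr => l _.
by rewrite !mxE mulrA.
Qed.

(** This is the dimension of the closure of the image, by [has_zariski_dim_range]. Ranks are at most
    n, so the maximum runs over a finite type. *)
Definition jdim n m (f : 'I_m -> {mpoly F[n]}) : nat :=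
  \max_(r < n.+1 | `[< exists v, \rank (jacobian f v) = r >]) r.

Lemma jdim_ge n m (f : 'I_m -> {mpoly F[n]}) v :
  (\rank (jacobian f v) <= jdim f)%N.
Proof.
have rn : (\rank (jacobian f v) < n.+1)%N by rewrite ltnS rank_leq_row.
by apply: (@leq_bigmax_cond _ _ _ (Ordinal rn)); apply/asboolP; exists v.
Qed.

Lemma jdim_attained n m (f : 'I_m -> {mpoly F[n]}) :
  exists v, \rank (jacobian f v) = jdim f.
Proof.
have r0 : (\rank (jacobian f 0) < n.+1)%N by rewrite ltnS rank_leq_row.
have P0 : `[< exists v, \rank (jacobian f v) = Ordinal r0 >].
  by apply/asboolP; exists 0.
rewrite /jdim (bigmax_eq_arg (Ordinal r0)) //; case: arg_maxnP => // i /asboolP[v] rv _.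
by exists v.
Qed.

Lemma jdim_leP n m (f : 'I_m -> {mpoly F[n]}) r :
  (forall v, \rank (jacobian f v) <= r)%N <-> (jdim f <= r)%N.
Proof.
split=> [fr|fr v]; first by have [v <-] := jdim_attained f.
exact: leq_trans (jdim_ge f v) fr.
Qed.

Lemma jdim_postcomp n m k (f : 'I_m -> {mpoly F[n]}) (g : 'I_k -> {mpoly F[m]}) :
  (jdim (fun j => psubst f (g j)) <= jdim f)%N.
Proof.
apply/jdim_leP => v; rewrite jacobian_psubst.
exact: leq_trans (mxrankM_maxl _ _) (jdim_ge f v).
Qed.

Lemma jdim_precomp n m k (f : 'I_m -> {mpoly F[n]}) (g : 'I_k -> {mpoly F[m]}) :
  (jdim (fun j => psubst f (g j)) <= jdim g)%N.
Proof.
apply/jdim_leP => v; rewrite jacobian_psubst.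
exact: leq_trans (mxrankM_maxr _ _) (jdim_ge g _).
Qed.

Lemma jdim_generic n m (f : 'I_m -> {mpoly F[n]}) q :
  q != 0 -> exists v, mpoly_at q v != 0 /\ \rank (jacobian f v) = jdim f.
Proof.
move=> q0; have [v rv] := jdim_attained f.
have [d d0 dP] := jacobian_rank_generic f v.
have [u] := mpoly_at_neq0 (mulf_neq0 q0 d0).
rewrite mpoly_atM mulf_eq0 negb_or => /andP[qu /dP]; rewrite rv => ru.
by exists u; split=> //; apply/eqP; rewrite eqn_leq jdim_ge.
Qed.

(** Semicontinuity of the rank on a line; the generic value is taken at t != 0, where one may divide
    by powers of t. *)
Lemma rank_poly_mx n m (M : 'M[{poly F}]_(n, m)) :
  exists2 t, t != 0 &
    (\rank (map_mx (fun q => q.[0]) M) <= \rank (map_mx (fun q => q.[t]) M))%N.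
Proof.
have cE (t : F) : cancel polyC (horner_eval t) by move=> c; rewrite /horner_eval hornerC.
have [d d0 dP] := rank_specialization M (cE 0).
have [t /andP[t0 dt]] : exists t, (t != 0) && (d.[t] != 0).
  apply: contrapT => H; case/eqP: d0; apply: poly_eq0_nonzero => t t0.
  by apply/eqP; apply: contrapT => /negP dt; apply: H; exists t; apply/andP.
by exists t => //; exact: (dP (horner_eval t) (cE t) dt).
Qed.

End GenericRank.

Local Open Scope classical_set_scope.

(** * The dimension of the closure of an image *)

Section ZariskiClosure.
Variables (F : fieldType) (n : nat).
Implicit Types X A : set 'rV[F]_n.

Lemma zariski_closure_vanish X p :
    (forall x, X x -> mpoly_at p x = 0) ->
  forall x, zariski_closure X x -> mpoly_at p x = 0.
Proof.
move=> pX x Xx; apply: (Xx (zero_locus [set p])) => //; first by exists [set p].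
by move=> y /pX py q ->.
Qed.

Lemma sub_zariski_closure X : X `<=` zariski_closure X.
Proof. by move=> x Xx A _; apply. Qed.

Lemma closed_zariski_closure X : zariski_closed (zariski_closure X).
Proof.
exists [set p | forall x, X x -> mpoly_at p x = 0].
apply/seteqP; split=> x Xx; first by move=> p /zariski_closure_vanish; apply.
by move=> A [S ->] XS p Sp; apply: Xx => y /XS; apply.
Qed.

Lemma zariski_closure_sub X A :
  zariski_closed A -> X `<=` A -> zariski_closure X `<=` A.
Proof. by move=> cA XA x; apply. Qed.

Lemma zariski_closureS X A :
  X `<=` A -> zariski_closure X `<=` zariski_closure A.
Proof.
move=> XA; apply: zariski_closure_sub; first exact: closed_zariski_closure.
by move=> x /XA; apply: sub_zariski_closure.
Qed.

End ZariskiClosure.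

Section Dimension.
Variable F : numFieldType.

(** If some equation of A has a nonzero pullback, then wherever that pullback is nonzero the image
    lies in B; so every equation of B pulls back to a polynomial vanishing on a nonempty open set,
    hence to 0. *)
Lemma irreducible_closure_range n m (f : 'I_m -> {mpoly F[n]}) :
  zariski_irreducible (zariski_closure (range (polymap f))).
Proof.
split; first by exists (polymap f 0); apply: sub_zariski_closure; exists 0.
move=> A B cA cB sAB; have [SA EA] := cA; have [SB EB] := cB.
have [sA|nsA] := EM (range (polymap f) `<=` A).
  by left; apply: zariski_closure_sub.
right; apply: zariski_closure_sub => // _ [v _ <-]; rewrite EB => q Sq.
rewrite -mpoly_at_psubst.
have [p [Sp pf0]] : exists p, SA p /\ psubst f p != 0.
  apply: contrapT => H; apply: nsA => _ [u _ <-]; rewrite EA => p Sp.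
  rewrite -mpoly_at_psubst; have [->|pf0] := eqVneq (psubst f p) 0.
    by rewrite mpoly_at0.
  by case: H; exists p.
suff -> : psubst f q = 0 by rewrite mpoly_at0.
apply: mpoly_eq0_generic pf0 _ => u; rewrite !mpoly_at_psubst => pu.
have : (A `|` B) (polymap f u) by apply: sAB; apply: sub_zariski_closure; exists u.
case; last by rewrite EB; apply.
by rewrite EA => /(_ p Sp) pu0; rewrite pu0 eqxx in pu.
Qed.

Definition indep_on m k (Z : set 'rV[F]_m) (h : 'I_k -> {mpoly F[m]}) :=
  forall p, (forall z, Z z -> mpoly_at (psubst h p) z = 0) -> p = 0.

(** Split a relation on Z' as p0(h) + x * q. On Z the second term vanishes, so p0 = 0; then x * q
    vanishes on the irreducible Z', where x does not, so q is a smaller relation. *)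
Lemma indep_on_fcons m k (Z Z' : set 'rV[F]_m) (h : 'I_k -> {mpoly F[m]}) x :
    Z `<=` Z' -> zariski_irreducible Z' -> indep_on Z h ->
    (forall z, Z z -> mpoly_at x z = 0) ->
    ~ (forall z, Z' z -> mpoly_at x z = 0) ->
  indep_on Z' (fcons x h).
Proof.
move=> ZZ' [_ irr] indh xZ nxZ' p.
have [s] := ubnP (msize p); elim: s p => // s IHs p ps pZ'.
have [->//|p0] := eqVneq p 0.
have [q pE qp] := mdrop_decomp p.
have d0 : mdrop p = 0.
  apply: indh => z Zz; have := pZ' z (ZZ' z Zz); rewrite {1}pE psubstD psubstM.
  rewrite psubstX fcons0 mpoly_atD mpoly_atM xZ // mul0r addr0 => pz; rewrite -[RHS]pz.
  rewrite /mlift [in RHS]psubst_comp; congr mpoly_at; apply: eq_psubst => j.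
  by rewrite psubstX fconsS.
move: pE; rewrite d0 /mlift psubst0 add0r => pE.
suff q0 : q = 0 by rewrite pE q0 mulr0.
apply: IHs.
  by apply: leq_ltn_trans qp _; rewrite -ltnS prednK // lt0n mmeasure_poly_eq0.
have := irr (zero_locus [set x]) (zero_locus [set psubst (fcons x h) q]).
case; [by exists [set x] | by exists [set psubst (fcons x h) q] | | |].
- move=> z Z'z; have := pZ' z Z'z; rewrite pE psubstM psubstX fcons0 mpoly_atM.
  by move/eqP; rewrite mulf_eq0 => /orP[/eqP e|/eqP e]; [left|right] => _ ->.
- by move=> Z'x; case: nxZ' => z /Z'x; apply.
by move=> Z'q z /Z'q; apply.
Qed.

(* Choosing h i vanishing on Z i but not on Z i.+1 gives independent functions. *)
Lemma chain_indep m (X : set 'rV[F]_m) e (Z : nat -> set 'rV[F]_m) :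
  irreducible_chain X e Z -> exists h : 'I_e -> {mpoly F[m]}, indep_on (Z e) h.
Proof.
elim: e => [|e IHe] [Zi Zs].
  have [_ [[z Zz] _] _] := Zi 0%N isT.
  exists (fun=> 0) => p /(_ z Zz).
  have -> : p = (p@_0%MM)%:MP by apply: mderiv_eq0_const; case.
  by rewrite psubstC mpoly_atC => ->.
have [|h indh] := IHe.
  by split=> i ie; [apply: Zi; apply: leqW | apply: Zs; apply: leqW].
have [ZZ' /existsNP[z /not_implyP[Z'z nZz]]] := Zs e (ltnSn e).
have [[S ES] _ _] := Zi e (leqnSn e); have [_ irr _] := Zi e.+1 (leqnn _).
have [x [Sx xz]] : exists x, S x /\ mpoly_at x z <> 0.
  apply: contrapT => H; apply: nZz; rewrite ES => x Sx.
  by apply: contrapT => xz; apply: H; exists x.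
exists (fcons x h); apply: indep_on_fcons irr indh _ _ => //.
  by move=> y; rewrite ES; apply.
by move/(_ z Z'z).
Qed.

Lemma chain_length_le n m (f : 'I_m -> {mpoly F[n]}) e Z :
  irreducible_chain (zariski_closure (range (polymap f))) e Z -> (e <= jdim f)%N.
Proof.
move=> chZ; have [h indh] := chain_indep chZ.
have indfh : alg_indep (fun j => psubst f (h j)).
  move=> p; rewrite -psubst_comp => pf; apply: indh => z Zz.
  have [/(_ e (leqnn e))[_ _ /(_ z Zz) Xz] _] := chZ.
  apply: (zariski_closure_vanish _ Xz) => _ [v _ <-].
  by rewrite -mpoly_at_psubst pf mpoly_at0.
have [v <-] := alg_indep_jacobian indfh.
exact: leq_trans (jdim_ge _ v) (jdim_postcomp _ _).
Qed.

Definition affmap n m (A : 'M[F]_(n, m)) (c : 'rV[F]_m) j : {mpoly F[n]} :=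
  \sum_i A i j *: 'X_i + (c 0 j)%:MP.

Lemma jacobian_affmap n m (A : 'M[F]_(n, m)) c v : jacobian (affmap A c) v = A.
Proof.
apply/matrixP => i j; rewrite mxE mderivD mderivC addr0 raddf_sum /=.
rewrite mpoly_at_sum (bigD1 i) //= big1 => [|k ki];
  rewrite mderivZ mpoly_atZ mpoly_at_mderivX.
  by rewrite eqxx mulr1 addr0.
by rewrite (negPf ki) mulr0.
Qed.

Lemma polymap_affmap n m (A : 'M[F]_(n, m)) c v :
  polymap (affmap A c) v = v *m A + c.
Proof.
apply/rowP => j; rewrite !mxE mpoly_atD mpoly_atC mpoly_at_sum; congr (_ + _).
by apply: eq_bigr => i _; rewrite mpoly_atZ mpoly_atX mulrC.
Qed.

(** A relation that holds on an image holds on its closure. So linear functions of the target whose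
    pullbacks by [f] are independent also have independent pullbacks by [g], and as many as the rank
    of [f] are available. *)
Lemma jdim_closure n n' m (f : 'I_m -> {mpoly F[n]}) (g : 'I_m -> {mpoly F[n']}) :
  range (polymap f) `<=` zariski_closure (range (polymap g)) -> (jdim f <= jdim g)%N.
Proof.
move=> fg; have [v <-] := jdim_attained f; set J := jacobian f v.
have [C JC] : exists C, row_base J *m C = 1%:M.
  by apply/row_freeP; apply: row_base_free.
pose h := affmap C 0.
have indf : alg_indep (fun j => psubst f (h j)).
  apply: (@jacobian_alg_indep _ _ _ _ v).
  rewrite jacobian_psubst jacobian_affmap -/J.
  have -> : J *m C = col_base J by rewrite -[RHS]mulmx1 -JC mulmxA mulmx_base.
  exact/eqP/col_base_full.
have indg : alg_indep (fun j => psubst g (h j)).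
  move=> p; rewrite -psubst_comp => pg; apply: indf; rewrite -psubst_comp.
  apply: mpoly_at_inj0 => u; rewrite mpoly_at_psubst.
  have Xu : zariski_closure (range (polymap g)) (polymap f u).
    by apply: fg; exists u.
  apply: (zariski_closure_vanish _ Xu) => _ [u' _ <-].
  by rewrite -mpoly_at_psubst pg mpoly_at0.
have [u <-] := alg_indep_jacobian indg.
exact: leq_trans (jdim_ge _ u) (jdim_postcomp _ _).
Qed.

Lemma polymap_psubst n m k (f : 'I_m -> {mpoly F[n]}) (g : 'I_k -> {mpoly F[m]}) v :
  polymap (fun j => psubst f (g j)) v = polymap g (polymap f v).
Proof. by apply/rowP => j; rewrite !mxE mpoly_at_psubst. Qed.

(* A chain of maximal length is cut out by affine subspaces of the source
   through a point where the Jacobian has maximal rank. *)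
Lemma jdim_chain n m (f : 'I_m -> {mpoly F[n]}) :
  exists Z, irreducible_chain (zariski_closure (range (polymap f))) (jdim f) Z.
Proof.
have [v <-] := jdim_attained f; set J := jacobian f v; set r := \rank J.
have /row_fullP[B BJ] : row_full (col_base J) by apply: col_base_full.
(* Since B *m J = [row_base J], the rows of B are directions on which J keeps full rank; [pid_mx i]
   retains the first i of them. *)
pose L i := affmap (pid_mx i *m B : 'M_(r, n)) v.
have LE i u : polymap (L i) u = u *m (pid_mx i *m B) + v.
  exact: polymap_affmap.
pose fL i j := psubst (L i) (f j).
have dim_fL i : (i <= r)%N -> jdim (fL i) = i.
  move=> ir; apply/eqP; rewrite eqn_leq; apply/andP; split.
    apply/jdim_leP => u; rewrite jacobian_psubst jacobian_affmap.
    apply: leq_trans (mxrankM_maxl _ _) _; apply: leq_trans (mxrankM_maxl _ _) _.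
    by rewrite rank_pid_mx.
  apply: leq_trans (jdim_ge _ 0); rewrite jacobian_psubst jacobian_affmap LE mul0mx.
  rewrite add0r -/J -mulmxA.
  have -> : B *m J = row_base J by rewrite -[RHS]mul1mx -BJ -mulmxA mulmx_base.
  by rewrite mxrankMfree ?row_base_free // rank_pid_mx.
exists (fun i => zariski_closure (range (polymap (fL i)))).
have sL i i' : (i <= i')%N ->
    range (polymap (fL i)) `<=` range (polymap (fL i')).
  move=> ii' _ [u _ <-]; exists (u *m pid_mx i) => //.
  rewrite !polymap_psubst !LE -[u *m pid_mx i *m _]mulmxA [pid_mx i *m (_ *m B)]mulmxA.
  by rewrite mul_pid_mx (minn_idPl ii') pid_mx_minh.
split=> i ir.
  split; first exact: closed_zariski_closure.
    exact: irreducible_closure_range.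
  apply: zariski_closureS => _ [u _ <-]; rewrite polymap_psubst.
  by exists (polymap (L i) u).
split; first by apply: zariski_closureS; apply: sL; apply: leqnSn.
(* The reverse inclusion would give i + 1 <= i by monotonicity of [jdim]. *)
move=> sub; have: (jdim (fL i.+1) <= jdim (fL i))%N.
  apply: jdim_closure; apply: subset_trans sub; exact: sub_zariski_closure.
by rewrite !dim_fL ?ltnn // ltnW.
Qed.

Lemma has_zariski_dim_range n m (f : 'I_m -> {mpoly F[n]}) d :
  has_zariski_dim (zariski_closure (range (polymap f))) d <-> d = jdim f.
Proof.
split=> [[[Z /chain_length_le dZ] maxd]|->].
  have [Z' /maxd] := jdim_chain f.
  by move=> fd; apply/eqP; rewrite eqn_leq dZ.
split; first exact: jdim_chain.
by move=> e Z; apply: chain_length_le.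
Qed.

End Dimension.

(** * Degeneration to lowest weighted parts *)

Section LowestPart.
Variable F : numFieldType.

Definition dilation n (w : 'I_n -> nat) (t : F) (i : 'I_n) : {mpoly F[n]} :=
  t ^+ w i *: 'X_i.

Lemma polymap_dilation n (w : 'I_n -> nat) t v :
  polymap (dilation w t) v = wscale w t v.
Proof. by apply/rowP => i; rewrite !mxE mpoly_atZ mpoly_atX. Qed.

Lemma psubst_dilation n (w : 'I_n -> nat) t k (p : {mpoly F[n]}) :
    (wsize w p <= k)%N ->
  psubst (dilation w t) p = \sum_(d < k) t ^+ d *: wpart w d p.
Proof.
move=> pk; apply/eqP; rewrite -subr_eq0; apply/eqP/mpoly_at_inj0 => v.
rewrite mpoly_atB mpoly_at_psubst polymap_dilation (mpoly_at_wscale_sum _ _ pk).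
by rewrite mpoly_at_sum; apply/eqP; rewrite subr_eq0; apply/eqP/eq_bigr => d _;
   rewrite mpoly_atZ.
Qed.

(* For t != 0 the Jacobian of f (t . v) with its columns divided by t ^ a j is
   equivalent to that of f at t . v; at t = 0 it is that of the lowest part. *)
Lemma jdim_lowest n m (w : 'I_n -> nat) (a : 'I_m -> nat)
    (f : 'I_m -> {mpoly F[n]}) :
    (forall j d, (d < a j)%N -> wpart w d (f j) = 0) ->
  (jdim (fun j => wpart w (a j) (f j)) <= jdim f)%N.
Proof.
move=> low; have [v <-] := jdim_attained (fun j => wpart w (a j) (f j)).
pose k := (\max_j wsize w (f j)).+1.
have fk j : (wsize w (f j) <= k)%N.
  by apply: leqW; apply: (leq_bigmax (F := fun j => wsize w (f j))).
pose c i j d := mpoly_at (wpart w d (f j))^`M(i) v.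
pose M : 'M[{poly F}]_(n, m) := \matrix_(i, j) \poly_(d < k) c i j (a j + d)%N.
have [t t0] := rank_poly_mx M.
have -> : map_mx (fun q : {poly F} => q.[0]) M =
          jacobian (fun j => wpart w (a j) (f j)) v.
  by apply/matrixP => i j; rewrite !mxE horner_coef0 coef_poly addn0.
move=> le; apply: leq_trans le _.
suff -> : map_mx (fun q => q.[t]) M =
    jacobian (dilation w t) v *m jacobian f (wscale w t v) *m
      diag_mx (\row_j t ^- a j).
  apply: leq_trans (mxrankM_maxl _ _) _; apply: leq_trans (mxrankM_maxr _ _) _.
  exact: jdim_ge.
rewrite -polymap_dilation -jacobian_psubst; apply/matrixP => i j.
rewrite mul_mx_diag !mxE horner_poly.
rewrite (@psubst_dilation _ _ _ (a j + k)); last first.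
  by apply: leq_trans (fk j) _; rewrite leq_addl.
rewrite raddf_sum mpoly_at_sum big_split_ord /= [X in X + _]big1 ?add0r => [|d _]; last first.
  by rewrite low ?ltn_ord // scaler0 mderiv0 mpoly_at0.
rewrite mulr_suml; apply: eq_bigr => d _.
have ta : t ^+ a j != 0 by rewrite expf_neq0.
apply: (mulIf ta); rewrite mulfVK // mderivZ mpoly_atZ exprD.
by rewrite mulrC [c _ _ _ * _]mulrC mulrA.
Qed.

End LowestPart.

(** * Faithful covariants *)

Section FaithfulCovariants.
Variables (F : numFieldType) (gT : finGroupType) (G : {group gT}).

Definition equivariant n m (rV : mx_representation F G n)
    (rW : mx_representation F G m) (f : 'I_m -> {mpoly F[n]}) :=
  forall g v, g \in G -> polymap f (v *m rV g) = polymap f v *m rW g.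

Definition faithful_covariant n m (rV : mx_representation F G n)
    (rW : mx_representation F G m) (f : 'I_m -> {mpoly F[n]}) :=
  equivariant rV rW f /\ acts_faithfully_on rW (range (polymap f)).

Lemma has_faithful_covariantP d : has_faithful_covariant_of_dim F G d <->
  exists n m (rV : mx_representation F G n) (rW : mx_representation F G m) f,
    faithful_covariant rV rW f /\ jdim f = d.
Proof.
split=> [[n [m [rV [rW [phi [[[f phiE] eqv] ff dimphi]]]]]]|].
  have {}phiE : phi = polymap f by apply/funext.
  subst phi; exists n, m, rV, rW, f; split; first by split=> // g v; apply: eqv.
  exact/esym/has_zariski_dim_range.
move=> [n [m [rV [rW [f [[eqv ff] <-]]]]]].
exists n, m, rV, rW, (polymap f); split=> //; last exact/has_zariski_dim_range.
by split=> //; exists f.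
Qed.

Lemma covdimP n m (rV : mx_representation F G n) (rW : mx_representation F G m) f :
    faithful_covariant rV rW f ->
  is_covdim F G (covdim F G).
Proof.
move=> ff; apply: xgetPex.
have ex : exists d, `[< has_faithful_covariant_of_dim F G d >].
  exists (jdim f); apply/asboolP/has_faithful_covariantP.
  by exists n, m, rV, rW, f.
exists (ex_minn ex); case: ex_minnP => d /asboolP dP dmin.
by split=> // e /asboolP; apply: dmin.
Qed.

Lemma covdim_leq n m (rV : mx_representation F G n) (rW : mx_representation F G m) f :
  faithful_covariant rV rW f -> (covdim F G <= jdim f)%N.
Proof.
move=> ff; have [_ ] := covdimP ff; apply; apply/has_faithful_covariantP.
by exists n, m, rV, rW, f.
Qed.

Lemma covdim_attained n m (rV : mx_representation F G n)
    (rW : mx_representation F G m) f :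
    faithful_covariant rV rW f ->
  exists n' m' (rV' : mx_representation F G n') (rW' : mx_representation F G m') f',
    faithful_covariant rV' rW' f' /\ jdim f' = covdim F G.
Proof. by move=> /covdimP[/has_faithful_covariantP]. Qed.

Lemma mx_faithful_eq1 n (rV : mx_representation F G n) g :
  mx_faithful rV -> g \in G -> rV g = 1%:M -> g = 1%g.
Proof.
move=> /fintype.subsetP fV gG rg; apply/set1gP/fV; rewrite inE gG /=.
by rewrite mul1mx rg.
Qed.

Lemma mx_faithful_inj n (rV : mx_representation F G n) g h :
  mx_faithful rV -> g \in G -> h \in G -> rV g = rV h -> g = h.
Proof.
move=> fV gG hG gh; apply/eqP; rewrite eq_mulgV1; apply/eqP.
apply: (mx_faithful_eq1 fV); first by rewrite groupM ?groupV.
by rewrite repr_mxM ?groupV // gh -repr_mxM ?groupV // mulgV repr_mx1.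
Qed.

Lemma repr_scalar_exp n (rV : mx_representation F G n) g a k :
  g \in G -> rV g = a%:M -> rV (g ^+ k)%g = (a ^+ k)%:M.
Proof.
move=> gG rg; elim: k => [|k IHk]; first by rewrite expg0 repr_mx1.
by rewrite expgS repr_mxM ?groupX // rg IHk -scalar_mxM exprS.
Qed.

Lemma mx_faithfulP n (rV : mx_representation F G n) :
  (forall g, g \in G -> rV g = 1%:M -> g = 1%g) -> mx_faithful rV.
Proof.
move=> fV; apply/fintype.subsetP => g; rewrite inE mul1mx => /andP[gG /eqP rg].
by apply/set1gP/fV.
Qed.

Lemma eq_mulrow_mx (K : fieldType) n m (A B : 'M[K]_(n, m)) :
  (forall v : 'rV_n, v *m A = v *m B) -> A = B.
Proof. by move=> AB; apply/row_matrixP => i; rewrite !rowE. Qed.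

Lemma faithful_id n (rV : mx_representation F G n) :
  mx_faithful rV -> faithful_covariant rV rV (fun i => 'X_i).
Proof.
have idE v : polymap (fun i => 'X_i : {mpoly F[n]}) v = v.
  by apply/rowP => i; rewrite mxE mpoly_atX.
move=> fV; split=> [g v _|g gG fixg]; first by rewrite !idE.
apply: (mx_faithful_eq1 fV gG); apply: eq_mulrow_mx => v.
by rewrite mulmx1; apply: fixg; exists v.
Qed.

(** For each g other than 1 some coordinate of [f] moved by g, minus [f], is a nonzero polynomial;
    avoid the zeros of these finitely many polynomials and of q. *)
Lemma faithful_generic n m (rW : mx_representation F G m) (f : 'I_m -> {mpoly F[n]}) q :
    acts_faithfully_on rW (range (polymap f)) -> q != 0 ->
  exists v, mpoly_at q v != 0 /\
    forall g, g \in G -> polymap f v *m rW g = polymap f v -> g = 1%g.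
Proof.
move=> ff q0.
have ex g : exists p, p != 0 /\ (g \in G -> g != 1%g -> forall v, mpoly_at p v != 0 ->
    polymap f v *m rW g <> polymap f v).
  have [gG|] := boolP (g \in G); last by exists 1; rewrite oner_eq0.
  have [->|g1] := eqVneq g 1%g; first by exists 1; rewrite oner_eq0.
  pose p j := \sum_i rW g i j *: f i - f j.
  have pE v j : mpoly_at (p j) v = (polymap f v *m rW g) 0 j - polymap f v 0 j.
    rewrite mpoly_atB mpoly_at_sum !mxE; congr (_ - _); apply: eq_bigr => i _.
    by rewrite mpoly_atZ mxE mulrC.
  have [j pj] : exists j, p j != 0.
    apply: contrapT => p0; case/eqP: g1; apply: ff => // _ [v _ <-].
    apply/rowP => j; apply/eqP; rewrite -subr_eq0 -pE.
    have [->|pj] := eqVneq (p j) 0; first by rewrite mpoly_at0.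
    by case: p0; exists j.
  by exists (p j); split=> // _ _ v; rewrite pE => pv e; rewrite e subrr eqxx in pv.
have [p pP] := choice ex.
(* [None] carries the condition q, [Some g] the condition of g. *)
have [o|v vP] := @mpoly_generic F n (option gT) predT
    (fun o => if o is Some g then p g else q).
  by move=> _; apply: mpoly_at_neq0; case: o => // g; case: (pP g).
exists v; split=> [|g gG fixg]; first exact: (vP None).
apply/eqP; apply: contrapT => /negP g1.
by have [_ /(_ gG g1 v)] := pP g; apply=> //; apply: (vP (Some g)).
Qed.

Lemma faithful_point n (rV : mx_representation F G n) :
    mx_faithful rV ->
  exists v : 'rV[F]_n, forall g, g \in G -> v *m rV g = v -> g = 1%g.
Proof.
move=> /faithful_id[_ /faithful_generic/(_ (oner_neq0 _))[v [_ fv]]].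
exists (polymap (fun i => 'X_i) v) => g; exact: fv.
Qed.

Lemma interpolate_point n (x : 'rV[F]_n) (S : seq 'rV[F]_n) :
  x \notin S -> exists p, mpoly_at p x = 1 /\ forall y, y \in S -> mpoly_at p y = 0.
Proof.
elim: S => [|y S IHS]; first by exists 1; rewrite mpoly_at1.
rewrite inE negb_or => /andP[xy /IHS[p [px pS]]].
have [i xyi] : exists i, x 0 i != y 0 i.
  apply/existsP; apply: contraNT xy => /existsPn e; apply/eqP/rowP => i.
  by apply/eqP; have := e i; rewrite negbK.
exists ((x 0 i - y 0 i)^-1 *: ('X_i - (y 0 i)%:MP) * p); split.
  by rewrite mpoly_atM px mpoly_atZ mpoly_atB mpoly_atX mpoly_atC mulVf ?mulr1 // subr_eq0.
move=> z; rewrite mpoly_atM inE => /orP[/eqP->|/pS->]; last by rewrite mulr0.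
by rewrite mpoly_atZ mpoly_atB mpoly_atX mpoly_atC subrr mulr0 mul0r.
Qed.

Lemma mpoly_at_mulmx n m (A : 'M[F]_(n, m)) p v :
  mpoly_at (psubst (affmap A 0) p) v = mpoly_at p (v *m A).
Proof. by rewrite mpoly_at_psubst polymap_affmap addr0. Qed.

(** Averaging over G a polynomial that is 1 at x and 0 at the other points of its orbit; the trivial
    stabilizer keeps x apart from its translates by the elements other than 1. *)
Lemma interpolate_covariant n m (rV : mx_representation F G n)
    (rW : mx_representation F G m) (x : 'rV_n) (y : 'rV_m) :
    (forall g, g \in G -> x *m rV g = x -> g = 1%g) ->
  exists f, equivariant rV rW f /\ polymap f x = y.
Proof.
move=> stabx; pose S := [seq x *m rV g | g in G :\ 1%g].
have /interpolate_point[p [px pS]] : x \notin S.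
  apply/fintype.imageP => -[g /setD1P[g1 gG] xg]; case/eqP: g1; exact: stabx.
pose f j := \sum_(g in G) (y *m rW g^-1%g) 0 j *: psubst (affmap (rV g) 0) p.
have fE v : polymap f v = \sum_(g in G) mpoly_at p (v *m rV g) *: (y *m rW g^-1%g).
  apply/rowP => j; rewrite mxE summxE mpoly_at_sum; apply: eq_bigr => g _.
  by rewrite mpoly_atZ mpoly_at_mulmx [RHS]mxE mulrC.
exists f; split=> [k v kG|]; rewrite !fE.
  rewrite mulmx_suml (reindex_inj (mulgI k^-1%g)) /=.
  apply: eq_big => [g|g]; rewrite groupMl ?groupV // => gG.
  rewrite -scalemxAl -!mulmxA -!repr_mxM ?groupM ?groupV //.
  by rewrite mulKVg invMg invgK.
rewrite (bigD1 1%g) //= big1 => [|g /andP[gG g1]].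
  by rewrite invg1 !repr_mx1 !mulmx1 px scale1r addr0.
by rewrite pS ?scale0r //; apply: fintype.image_f; rewrite !inE g1.
Qed.

Lemma faithful_covariant_transfer n m n' m' (rV : mx_representation F G n)
    (rW : mx_representation F G m) (rV' : mx_representation F G n')
    (rW' : mx_representation F G m') f :
    faithful_covariant rV rW f -> mx_faithful rV' -> mx_faithful rW' ->
  exists f', faithful_covariant rV' rW' f' /\ (jdim f' <= jdim f)%N.
Proof.
move=> [eqf ff] /faithful_point[x' stabx'] /faithful_point[y' staby'].
have [x [_ stabx]] := faithful_generic ff (oner_neq0 _).
have [a [eqa ax]] := interpolate_covariant rV x stabx'.
have [b [eqb bx]] := interpolate_covariant rW' y' stabx.
exists (fun j => psubst a (psubst f (b j))); split; last first.
  exact: leq_trans (jdim_precomp _ _) (jdim_postcomp _ _).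
split=> [g v gG|g gG fixg]; first by rewrite !polymap_psubst eqa // eqf // eqb.
by apply: staby' => //; apply: fixg; exists x' => //; rewrite !polymap_psubst ax bx.
Qed.

End FaithfulCovariants.

(** * Multihomogeneous covariants *)

Section Homogenization.
Variables (F : numFieldType) (gT : finGroupType) (G : {group gT}).

(* A module decomposed as a direct sum is encoded by a labelling b of the
   coordinates by the summands. *)
Definition block_diag n k (rW : mx_representation F G n) (b : 'I_n -> 'I_k) :=
  forall g i j, g \in G -> b i != b j -> rW g i j = 0.

(* The block-b component of a vector w, if nonzero, generates the whole block;
   this is how irreducibility of the blocks is used. *)
Definition block_irr n k (rW : mx_representation F G n) (b : 'I_n -> 'I_k) :=
  forall (w u : 'rV[F]_n) j0, w 0 j0 != 0 ->
  exists c : gT -> F, forall j, b j = b j0 ->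
    u 0 j = \sum_(h in G) c h * (w *m rW h) 0 j.

Lemma block_diag_entry n k (rW : mx_representation F G n) (b : 'I_n -> 'I_k)
    (u u' : 'rV[F]_n) g j :
    block_diag rW b -> g \in G -> (forall i, b i = b j -> u 0 i = u' 0 i) ->
  (u *m rW g) 0 j = (u' *m rW g) 0 j.
Proof.
move=> bd gG uu'; rewrite !mxE; apply: eq_bigr => i _.
have [/uu'->//|ij] := eqVneq (b i) (b j).
by rewrite bd ?mulr0.
Qed.

Lemma wscale_mulmx n (rV : mx_representation F G n) (w : 'I_n -> nat) t v g :
    (forall i j, w i != w j -> rV g i j = 0) ->
  wscale w t v *m rV g = wscale w t (v *m rV g).
Proof.
move=> wG; apply/rowP => j; rewrite !mxE mulr_sumr; apply: eq_bigr => i _.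
rewrite mxE mulrA; have [->|/wG->] := eqVneq (w i) (w j); first by [].
by rewrite !mulr0.
Qed.

(** One degree per block, the least that occurs in any of its coordinates: lowest parts taken
    coordinate by coordinate need not be equivariant. *)
Lemma lowest_degree n m k (w : 'I_n -> nat) (b : 'I_m -> 'I_k)
    (f : 'I_m -> {mpoly F[n]}) :
  exists a : 'I_k -> nat, (forall j d, (d < a (b j))%N -> wpart w d (f j) = 0) /\
    forall j, f j != 0 -> exists2 j', b j' = b j & wpart w (a (b j)) (f j') != 0.
Proof.
suff /choice[a aP] : forall x, exists d, (forall j e, b j = x -> (e < d)%N ->
    wpart w e (f j) = 0) /\
    forall j, b j = x -> f j != 0 -> exists2 j', b j' = x & wpart w d (f j') != 0.
  exists a; split=> [j d|j fj]; first by have [+ _] := aP (b j); apply.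
  by have [_ /(_ j erefl fj)] := aP (b j).
move=> x; have [ex|nex] := EM (exists d, [exists j, (b j == x) && (wpart w d (f j) != 0)]).
  exists (ex_minn ex); case: ex_minnP => d /existsP[j /andP[/eqP bj fj]] dmin.
  split=> [j' e bj' ed|_ _ _]; last by exists j.
  apply/eqP; apply: contraTT ed => fj'; rewrite -leqNgt dmin //.
  by apply/existsP; exists j'; rewrite bj' eqxx.
(* Here all coordinates of the block vanish, and any degree would do. *)
exists 0%N; split=> // j bj fj; case: nex; apply: contrapT => H; case/eqP: fj.
rewrite (wpart_sum (leqnn (wsize w (f j)))) big1 // => d _; apply/eqP.
apply: contrapT => /negP fd; apply: H; exists (d : nat).
by apply/existsP; exists j; rewrite bj eqxx.
Qed.

(** An element fixing all values of the lowest part [f'] fixes those of [f]: block by block, a value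
    of [f] is a combination of translates of one value of [f']. The inclusion of supports lets the
    construction be iterated for several weights. *)
Lemma homogenize n m k (rV : mx_representation F G n)
    (rW : mx_representation F G m) (b : 'I_m -> 'I_k) (w : 'I_n -> nat)
    (f : 'I_m -> {mpoly F[n]}) :
    block_diag rW b -> block_irr rW b ->
    (forall g i j, g \in G -> w i != w j -> rV g i j = 0) ->
    faithful_covariant rV rW f ->
  exists f' (a : 'I_k -> nat), [/\ faithful_covariant rV rW f',
    (jdim f' <= jdim f)%N, forall j, whomog w (a (b j)) (f' j)
    & forall j e, e \in msupp (f' j) -> e \in msupp (f j)].
Proof.
move=> bd irr wG [eqf ff]; have [a [low nz]] := lowest_degree w b f.
pose f' j := wpart w (a (b j)) (f j).
have eqf' : equivariant rV rW f'.
  move=> g v gG; apply/rowP => j; rewrite !mxE.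
  pose k' := (\max_j wsize w (f j) + (a (b j)).+1)%N.
  have fk i : (wsize w (f i) <= k')%N.
    apply: leq_trans (leq_addr _ _).
    exact: (leq_bigmax (F := fun j => wsize w (f j))).
  (* The degree-d part of the defect of equivariance; summed against powers of t it is the defect at
     a dilate, which is 0. *)
  pose c d := mpoly_at (wpart w d (f j)) (v *m rV g) -
    \sum_i mpoly_at (wpart w d (f i)) v * rW g i j.
  have c0 : c (a (b j)) = 0.
    apply: (@sum_exp_eq0 _ k'); last by rewrite /k' addnS ltnS leq_addl.
    move=> t t0; transitivity (polymap f (wscale w t v *m rV g) 0 j -
       (polymap f (wscale w t v) *m rW g) 0 j); last by rewrite eqf // subrr.
    rewrite wscale_mulmx => [|i i' ii']; last exact: wG.
    rewrite !mxE (mpoly_at_wscale_sum _ _ (fk j)).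
    under [X in _ - X]eq_bigr => i _.
      rewrite mxE (mpoly_at_wscale_sum _ _ (fk i)) mulr_suml; over.
    rewrite exchange_big -sumrB; apply: eq_bigr => d _ /=.
    rewrite /c mulrBr; congr (_ - _); rewrite mulr_sumr; apply: eq_bigr => i _.
    by rewrite mulrA.
  move/eqP: c0; rewrite subr_eq0 => /eqP->; apply: eq_bigr => i _.
  rewrite mxE /f'; have [->//|ij] := eqVneq (b i) (b j).
  by rewrite bd // !mulr0.
exists f', a; split=> //; last 1 first.
- by move=> j e /msupp_wpart.
- split=> // g gG fixg; apply: ff => // _ [v _ <-]; apply/rowP => j.
  have [[j1 bj1 fj1]|nex] := EM (exists2 j1, b j1 = b j & f j1 != 0); last first.
    have f0 i : b i = b j -> polymap f v 0 i = 0.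
      move=> bi; rewrite mxE; have [->|fi] := eqVneq (f i) 0.
        by rewrite mpoly_at0.
      by case: nex; exists i.
    rewrite f0 // (@block_diag_entry _ _ rW b _ 0) ?mul0mx ?mxE // => i bi.
    by rewrite f0 // mxE.
  have [j2 bj2] := nz _ fj1; rewrite -bj2 -/(f' j2) => /mpoly_at_neq0[x f'x].
  have [|c cE] := irr (polymap f' x) (polymap f v) j2; first by rewrite mxE.
  (* [u] agrees with [polymap f v] on the block of j, and g fixes it because translates of a value
     of [f'] are again values of [f']. *)
  pose u := \sum_(h in G) c h *: (polymap f' x *m rW h).
  have uE i : b i = b j -> polymap f v 0 i = u 0 i.
    move=> bi; rewrite cE ?bi ?bj2 // summxE; apply: eq_bigr => h _.
    by rewrite [RHS]mxE.
  rewrite uE // (@block_diag_entry _ _ rW b _ u) //; congr (fun_of_matrix _ 0 j).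
  rewrite /u mulmx_suml; apply: eq_bigr => h hG; rewrite -scalemxAl; congr (_ *: _).
  by rewrite -eqf' //; apply: fixg; exists (x *m rV h).
- exact: jdim_lowest.
by move=> j; apply: whomog_wpart.
Qed.

Lemma multihomogenize n m k l (rV : mx_representation F G n)
    (rW : mx_representation F G m) (bV : 'I_n -> 'I_l) (b : 'I_m -> 'I_k)
    (f : 'I_m -> {mpoly F[n]}) :
    block_diag rW b -> block_irr rW b -> block_diag rV bV ->
    faithful_covariant rV rW f ->
  exists f' (a : 'I_k -> 'I_l -> nat), [/\ faithful_covariant rV rW f',
    (jdim f' <= jdim f)%N &
    forall j x, whomog (fun i => (bV i == x) : nat) (a (b j) x) (f' j)].
Proof.
move=> bd irr bdV ff.
suff [f' [a [ff' lef' hf']]] : exists f' (a : 'I_k -> 'I_l -> nat),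
    [/\ faithful_covariant rV rW f', (jdim f' <= jdim f)%N &
    forall j x, x \in enum 'I_l ->
      whomog (fun i => (bV i == x) : nat) (a (b j) x) (f' j)].
  by exists f', a; split=> // j x; apply: hf'; rewrite mem_enum.
(* One source block at a time; supports only shrink, so the homogeneity already gained is kept. *)
elim: (enum _) => [|y s [f1 [a [ff1 lef1 hf1]]]].
  by exists f, (fun _ _ => 0%N).
have [|f' [d [ff' lef' hf' suppf']]] :=
  homogenize (w := fun i => (bV i == y) : nat) bd irr _ ff1.
  by move=> g i j gG ij; apply: bdV gG _; apply: contraNneq ij => ->.
exists f', (fun c x => if x == y then d c else a c x); split=> //.
  exact: leq_trans lef1.
move=> j x; rewrite inE; case: eqVneq => [-> _|_ /= xs]; first exact: hf'.
by move=> e /suppf'; apply: hf1.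
Qed.

Lemma euler n (w : 'I_n -> nat) d (p : {mpoly F[n]}) (v : 'rV[F]_n) :
    whomog w d p ->
  \sum_i (w i)%:R * v 0 i * mpoly_at p^`M(i) v = d%:R * mpoly_at p v.
Proof.
move=> hp; rewrite [in RHS](mpolyE p) mpoly_at_sum mulr_sumr.
transitivity (\sum_i \sum_(e <- msupp p)
    (w i)%:R * v 0 i * mpoly_at (p@_e *: 'X_[e])^`M(i) v).
  by apply: eq_bigr => i _; rewrite {1}(mpolyE p) raddf_sum mpoly_at_sum mulr_sumr.
rewrite exchange_big big_seq [RHS]big_seq; apply: eq_bigr => e /hp <- /=.
rewrite natr_sum mulr_suml; apply: eq_bigr => i _.
rewrite mderivZ mderivX !mpoly_atZ natrM.
(* Subtraction of exponents is truncated, so e i = 0 is treated apart; both sides are then 0. *)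
have [->|ei] := eqVneq (e i) 0%N; first by rewrite !(mul0r, mulr0).
have -> : mpoly_at 'X_[e] v = v 0 i * mpoly_at 'X_[e - U_(i)] v.
  by rewrite -mpoly_atX -mpoly_atM -mpolyXD addmC submK // lep1mP.
ring.
Qed.

End Homogenization.

(** * Products with a cyclic group of order p *)

Section Pullback.
Variables (F : numFieldType) (gT hT : finGroupType).
Variables (G : {group gT}) (H : {group hT}) (h : gT -> hT).
Hypothesis hM : {in G &, {morph h : x y / (x * y)%g}}.
Hypothesis hG : forall g, g \in G -> h g \in H.

(** [h] is a plain function multiplicative on G, so inclusions, projections and changes of
    coordinates can be supplied without building morphisms. *)
Lemma pull_mx_repr n (rH : mx_representation F H n) : mx_repr G (rH \o h).
Proof.
split=> [|x y xG yG] /=; last by rewrite hM // repr_mxM ?hG.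
suff -> : h 1%g = 1%g by rewrite repr_mx1.
by apply: (mulgI (h 1%g)); rewrite -hM ?group1 // !mulg1.
Qed.

Definition pull_repr n (rH : mx_representation F H n) :=
  MxRepresentation (pull_mx_repr rH).

Lemma covdim_pull n m (rV : mx_representation F H n) (rW : mx_representation F H m) f :
    faithful_covariant rV rW f -> (forall g, g \in G -> h g = 1%g -> g = 1%g) ->
  (covdim F G <= covdim F H)%N.
Proof.
move=> /covdim_attained[n' [m' [rV' [rW' [f' [[eqf ff] <-]]]]]] inj_h.
apply: (@covdim_leq _ _ _ _ _ (pull_repr rV') (pull_repr rW')).
split=> [g v gG|g gG fixg]; first by rewrite /= eqf ?hG.
by apply: inj_h => //; apply: ff => //; apply: hG.
Qed.

End Pullback.

(** * One factor Z/p when each block has its own element acting by [omega] *)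

Section BlockModules.
Variables (F : numFieldType) (p : nat) (omega : F).
Hypotheses (p_prime : prime p) (prim : p.-primitive_root omega).

Definition block_scalar n k (b : 'I_n -> 'I_k) (x : 'I_k) : 'M[F]_n :=
  diag_mx (\row_j (if b j == x then omega else 1)).

(** The induction invariant of (2): [z x] acts by [omega] on block x and trivially on the other
    blocks. *)
Definition pmodule (gT : finGroupType) (G : {group gT}) n k
    (rW : mx_representation F G n) (b : 'I_n -> 'I_k) (z : 'I_k -> gT) :=
  [/\ block_diag rW b, block_irr rW b, mx_faithful rW, forall x, exists j, b j = x
    & forall x, z x \in G /\ rW (z x) = block_scalar b x].

Definition has_pmodule (gT : finGroupType) (G : {group gT}) :=
  exists n k (rW : mx_representation F G n) (b : 'I_n -> 'I_k) z, pmodule rW b z.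

Section Degrees.
Variables (gT : finGroupType) (G : {group gT}) (n k : nat).
Variables (rW : mx_representation F G n) (b : 'I_n -> 'I_k) (z : 'I_k -> gT).
Hypothesis pW : pmodule rW b z.
Variable f : 'I_n -> {mpoly F[n]}.
Hypothesis ff : faithful_covariant rW rW f.

(** Otherwise [z x], which acts on block x only, would fix the whole image. *)
Lemma pmodule_neq0 x : exists2 j, b j = x & f j != 0.
Proof.
have [_ _ _ /(_ x)[j bj] /(_ x)[zG rz]] := pW; have [_ fixf] := ff.
apply: contrapT => nex; have /eqP : rW (z x) = 1%:M.
  rewrite (fixf (z x)) ?repr_mx1 // => _ [v _ <-]; rewrite rz.
  apply/rowP => i; rewrite mul_mx_diag !mxE.
  have [bi|_] := eqVneq (b i) x; last by rewrite mulr1.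
  have [->|fi] := eqVneq (f i) 0; first by rewrite mpoly_at0 mul0r.
  by case: nex; exists i.
rewrite rz => /eqP/matrixP/(_ j j); rewrite !mxE bj !eqxx => w1.
have := prim_order_dvd prim 1; rewrite expr1 -[omega]mulr1n w1 eqxx dvdn1 => /eqP p1.
by have := prime_gt1 p_prime; rewrite p1.
Qed.

(** Equivariance under [z x], read at a nonzero component of block c, says that [omega] has the same
    power with exponents a c x and (c == x). *)
Lemma degree_mod (a : 'I_k -> 'I_k -> nat) :
    (forall j x, whomog (fun i => (b i == x) : nat) (a (b j) x) (f j)) ->
  forall c x, a c x = (c == x) %[mod p].
Proof.
move=> hf c x; have [j <-{c} /mpoly_at_neq0[v fv]] := pmodule_neq0 c.
have [_ _ _ _ /(_ x)[zG rz]] := pW; have [eqf _] := ff.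
have vz : v *m rW (z x) = wscale (fun i => (b i == x) : nat) omega v.
  rewrite rz; apply/rowP => i; rewrite mul_mx_diag !mxE mulrC.
  by case: eqP => _; rewrite ?expr1 ?expr0.
have /rowP/(_ j) := eqf (z x) v zG.
rewrite vz rz mul_mx_diag !mxE (mpoly_at_wscale _ _ (hf j x)) [RHS]mulrC.
move/(mulIf fv) => e; apply/eqP; rewrite -(eq_prim_root_expr prim) e.
by case: (b j == x); rewrite ?expr1 ?expr0.
Qed.

End Degrees.

(** The determinant is an integer congruent to 1 mod p, hence nonzero, and remains so in
    characteristic 0. *)
Lemma unitmx_mod1 k (a : 'I_k -> 'I_k -> nat) :
    (forall c x, a c x = (c == x) %[mod p]) ->
  (\matrix_(c, x) (a c x)%:R : 'M[F]_k) \in unitmx.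
Proof.
move=> a1; pose A : 'M[int]_k := \matrix_(c, x) (a c x)%:R.
have detA : \det A != 0.
  apply: contraTneq (oner_neq0 'F_p) => detA; rewrite negbK.
  have <- : \det (map_mx (intr : int -> 'F_p) A) = 1.
    rewrite -[RHS](det1 _ k); congr (\det _); apply/matrixP => c x; rewrite !mxE.
    rewrite mulrz_nat -(Fp_nat_mod p_prime (a c x)) a1 Fp_nat_mod //.
  by rewrite det_map_mx detA rmorph0.
rewrite unitmxE unitfE.
have -> : \matrix_(c, x) (a c x)%:R = map_mx (intr : int -> F) A.
  by apply/matrixP => c x; rewrite !mxE mulrz_nat.
by rewrite det_map_mx intr_eq0.
Qed.

Section Extension.
Variables (gT : finGroupType) (G : {group gT}).
Local Notation GC := (setX_group G [set: 'Z_p]%G).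

(** The group law of ['Z_p] is addition mod p, so this is the character of Z/p given by [omega]. *)
Lemma omegaM (c d : 'Z_p) : omega ^+ (c * d)%g = omega ^+ c * omega ^+ d.
Proof.
rewrite -exprD -(prim_expr_mod prim (c + d)) /=.
by rewrite [in X in modn _ X]Zp_cast ?prime_gt1.
Qed.

Lemma omega_eq1 (c : 'Z_p) : omega ^+ c = 1 -> c = 1%g.
Proof.
move/eqP; rewrite -(prim_order_dvd prim) => pc; apply/val_inj => /=.
have : (c < p)%N by rewrite -[X in (_ < X)%N]Zp_cast ?prime_gt1.
by case: (c : nat) pc => // c' /(dvdn_leq (ltn0Sn _)); rewrite leqNgt => /negPf->.
Qed.

Definition ext_mx n (rV : mx_representation F G n) (x : gT * 'Z_p) : 'M[F]_(n + 1) :=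
  block_mx (rV x.1) 0 0 (omega ^+ x.2)%:M.

Lemma ext_mx_repr n (rV : mx_representation F G n) : mx_repr GC (ext_mx rV).
Proof.
split=> [|[g c] [h d] /setXP[gG _] /setXP[hG _]]; rewrite /ext_mx /=.
  by rewrite repr_mx1 -scalar_mx_block.
rewrite mulmx_block !mulmx0 !mul0mx !addr0 add0r -scalar_mxM -omegaM.
by rewrite repr_mxM.
Qed.

Definition ext_repr n (rV : mx_representation F G n) :=
  MxRepresentation (ext_mx_repr rV).

Definition ext_map n m (f : 'I_m -> {mpoly F[n]}) (j : 'I_(m + 1)) : {mpoly F[n + 1]} :=
  match split j with
  | inl j => psubst (fun i => 'X_(lshift 1 i)) (f j)
  | inr j => 'X_(rshift n j)
  end.

Lemma ext_mapl n m (f : 'I_m -> {mpoly F[n]}) j :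
  ext_map f (lshift 1 j) = psubst (fun i => 'X_(lshift 1 i)) (f j).
Proof. by rewrite /ext_map (unsplitK (inl j)). Qed.

Lemma ext_mapr n m (f : 'I_m -> {mpoly F[n]}) j :
  ext_map f (rshift m j) = 'X_(rshift n j).
Proof. by rewrite /ext_map (unsplitK (inr j)). Qed.

Lemma polymap_lshift n (v : 'rV[F]_(n + 1)) :
  polymap (fun i => 'X_(lshift 1 i)) v = lsubmx v.
Proof. by apply/rowP => i; rewrite !mxE mpoly_atX. Qed.

Lemma polymap_ext n m (f : 'I_m -> {mpoly F[n]}) v :
  polymap (ext_map f) v = row_mx (polymap f (lsubmx v)) (rsubmx v).
Proof.
apply/rowP => j; rewrite !mxE /ext_map; case: (split j) => i; rewrite !mxE.
  by rewrite mpoly_at_psubst polymap_lshift.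
by rewrite mpoly_atX.
Qed.

Lemma jacobian_ext n m (f : 'I_m -> {mpoly F[n]}) v :
  jacobian (ext_map f) v = block_mx (jacobian f (lsubmx v)) 0 0 1%:M.
Proof.
have fE i j : mpoly_at (psubst (fun i => 'X_(lshift 1 i)) (f j))^`M(i) v =
    \sum_l mpoly_at (f j)^`M(l) (lsubmx v) * (lshift 1 l == i)%:R.
  rewrite mderiv_psubst mpoly_at_sum; apply: eq_bigr => l _.
  by rewrite mpoly_atM mpoly_at_mderivX mpoly_at_psubst polymap_lshift.
apply/matrixP => i j; rewrite mxE.
case: (split_ordP i) => i' ->; case: (split_ordP j) => j' ->.
- rewrite ext_mapl fE block_mxEul mxE (bigD1 i') //= eqxx mulr1.
  by rewrite big1 ?addr0 // => l li; rewrite eq_lshift (negPf li) mulr0.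
- by rewrite ext_mapr mpoly_at_mderivX block_mxEur mxE eq_rlshift.
- rewrite ext_mapl fE block_mxEdl mxE big1 // => l _.
  by rewrite eq_lrshift mulr0.
by rewrite ext_mapr mpoly_at_mderivX block_mxEdr mxE eq_rshift eq_sym.
Qed.

Lemma jdim_ext n m (f : 'I_m -> {mpoly F[n]}) : (jdim (ext_map f) <= jdim f + 1)%N.
Proof.
apply/jdim_leP => v; rewrite jacobian_ext rank_diag_block_mx mxrank1.
by rewrite leq_add2r jdim_ge.
Qed.

Lemma mul_row_ext n (rV : mx_representation F G n) (v : 'rV_n) (s : 'rV_1) x :
  row_mx v s *m ext_mx rV x = row_mx (v *m rV x.1) (omega ^+ x.2 *: s).
Proof.
by rewrite /ext_mx mul_row_block !mulmx0 addr0 add0r mul_mx_scalar.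
Qed.

Lemma faithful_ext n m (rV : mx_representation F G n) (rW : mx_representation F G m) f :
  faithful_covariant rV rW f ->
  faithful_covariant (ext_repr rV) (ext_repr rW) (ext_map f).
Proof.
move=> [eqf ff]; split=> [[g c] v /setXP[gG _]|[g c] /setXP[gG _] fixx].
  rewrite -[v]hsubmxK /= mul_row_ext !polymap_ext !row_mxKl !row_mxKr.
  by rewrite eqf // mul_row_ext.
have fixv v s : polymap f v *m rW g = polymap f v /\ omega ^+ c *: s = s :> 'rV_1.
  have := fixx (row_mx (polymap f v) s); rewrite /= mul_row_ext => fixvs.
  by apply: eq_row_mx; apply: fixvs; exists (row_mx v s);
     rewrite // polymap_ext row_mxKl row_mxKr.
have -> : g = 1%g by apply: ff => // _ [v _ <-]; have [] := fixv v 0.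
have [_ /rowP/(_ 0)] := fixv 0 (const_mx 1).
by rewrite !mxE mulr1 => /omega_eq1->.
Qed.

Lemma covdim_ext_leq n m (rV : mx_representation F G n) (rW : mx_representation F G m) f :
  faithful_covariant rV rW f -> (covdim F GC <= covdim F G + 1)%N.
Proof.
move=> /covdim_attained[n' [m' [rV' [rW' [f' [/faithful_ext ff' <-]]]]]].
exact: leq_trans (covdim_leq ff') (jdim_ext f').
Qed.

Lemma mx_faithful_ext n (rV : mx_representation F G n) :
  mx_faithful rV -> mx_faithful (ext_repr rV).
Proof.
move=> fV; apply: mx_faithfulP => -[g c] /setXP[gG _] /=.
rewrite /ext_mx /= (@scalar_mx_block _ n 1) => /eq_block_mx[rg _ _ /matrixP/(_ 0 0)].
by rewrite !mxE => /omega_eq1 ->; rewrite (mx_faithful_eq1 fV gG rg).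
Qed.

Definition ext_block n k (b : 'I_n -> 'I_k) (j : 'I_(n + 1)) : 'I_(k + 1) :=
  match split j with
  | inl j => lshift 1 (b j)
  | inr j => rshift k j
  end.

Definition ext_center k (z : 'I_k -> gT) (x : 'I_(k + 1)) : gT * 'Z_p :=
  match split x with
  | inl x => (z x, 1%g)
  | inr _ => (1%g, Zp1)
  end.

Lemma ext_block_lshift n k (b : 'I_n -> 'I_k) j :
  ext_block b (lshift 1 j) = lshift 1 (b j).
Proof. by rewrite /ext_block (unsplitK (inl j)). Qed.

Lemma ext_block_rshift n k (b : 'I_n -> 'I_k) j :
  ext_block b (rshift n j) = rshift k j.
Proof. by rewrite /ext_block (unsplitK (inr j)). Qed.

Lemma pmodule_ext n k (rW : mx_representation F G n) (b : 'I_n -> 'I_k) z :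
  pmodule rW b z -> pmodule (ext_repr rW) (ext_block b) (ext_center z).
Proof.
move=> [bd irr fW sb zW]; split.
- move=> [g e] i j /setXP[gG _]; rewrite /= /ext_mx.
  case: (split_ordP i) => i' ->; case: (split_ordP j) => j' ->.
  + rewrite !ext_block_lshift eq_lshift block_mxEul; exact: bd.
  + by rewrite block_mxEur mxE.
  + by rewrite block_mxEdl mxE.
  by rewrite !ext_block_rshift !ord1 eqxx.
- move=> w u j0; rewrite -[w]hsubmxK -[u]hsubmxK.
  case: (split_ordP j0) => j ->; rewrite ?row_mxEl ?row_mxEr => w0.
    have [c cE] := irr _ (lsubmx u) _ w0.
    (* The elements (g, 1) already generate the old blocks; the sum over the product collapses to
       one over G. *)
    exists (fun x => if x.2 == 1%g then c x.1 else 0) => i.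
    case: (split_ordP i) => i' ->; last first.
      by rewrite ext_block_rshift ext_block_lshift => /eqP; rewrite eq_rlshift.
    rewrite !ext_block_lshift => /lshift_inj bi.
    rewrite row_mxEl cE // (eq_bigr (fun x : gT * 'Z_p =>
      (if x.2 == 1%g then c x.1 else 0) * (lsubmx w *m rW x.1) 0 i')); last first.
      by move=> x _; rewrite /= mul_row_ext row_mxEl.
    rewrite (eq_bigl (fun x : gT * 'Z_p => (x.1 \in G) && true)) => [|x]; last first.
      by rewrite inE inE.
    rewrite -(pair_big (mem G) xpredT (fun g (e : 'Z_p) =>
      (if e == 1%g then c g else 0) * (lsubmx w *m rW g) 0 i')) /=.
    apply: eq_bigr => g _; rewrite (bigD1 1%g) //= big1 ?addr0 // => e.
    by move=> /negPf->; rewrite mul0r.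
  (* On the new one-dimensional block a multiple of the identity is enough. *)
  exists (fun x => if x == 1%g then rsubmx u 0 j / rsubmx w 0 j else 0) => i.
  case: (split_ordP i) => i' ->.
    by rewrite ext_block_rshift ext_block_lshift => /eqP; rewrite eq_lrshift.
  move=> _; rewrite (bigD1 1%g) //= eqxx big1 => [|x /andP[_ /negPf->]].
    have /= -> := repr_mx1 (ext_repr rW).
    have -> : i' = j by rewrite !ord1.
    by rewrite mulmx1 !row_mxEr addr0 divfK.
  by rewrite mul0r.
- exact: mx_faithful_ext.
- move=> x; case: (split_ordP x) => x' ->.
    have [j bj] := sb x'; exists (lshift 1 j).
    by rewrite ext_block_lshift bj.
  by exists (rshift n x'); rewrite ext_block_rshift.
move=> x; rewrite /ext_center.
case: (split_ordP x) => x' ->; rewrite ?(unsplitK (inl x')) ?(unsplitK (inr x')).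
  have [zG rz] := zW x'; split; first by rewrite inE zG inE.
  rewrite /= /ext_mx /= rz expr0; apply/matrixP => i j.
  case: (split_ordP i) => i' ->; case: (split_ordP j) => j' ->.
  + rewrite block_mxEul !mxE eq_lshift ext_block_lshift eq_lshift.
    by [].
  + by rewrite block_mxEur !mxE eq_lrshift.
  + by rewrite block_mxEdl !mxE eq_rlshift.
  by rewrite block_mxEdr !mxE eq_rshift ext_block_rshift eq_rlshift.
split; first by rewrite inE group1 inE.
rewrite /= /ext_mx /= repr_mx1; apply/matrixP => i j.
case: (split_ordP i) => i' ->; case: (split_ordP j) => j' ->.
+ rewrite block_mxEul !mxE eq_lshift ext_block_lshift eq_lrshift. by [].
+ by rewrite block_mxEur !mxE eq_lrshift.
+ by rewrite block_mxEdl !mxE eq_rlshift.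
rewrite block_mxEdr !mxE eq_rshift ext_block_rshift !ord1 !eqxx.
by rewrite /Zp1 /= modn_small // expr1.
Qed.

(* The degree matrix A is the identity mod p, hence invertible. By Euler's
   identity the row space of the Jacobian at v contains, for every x, the row
   (A (b j) x * f j v)_j, hence also the last unit vector; so dropping the last
   component lowers the rank by one. *)
Lemma covdim_ext_geq n k (rW : mx_representation F G n) (b : 'I_n -> 'I_k) z :
  pmodule rW b z -> (covdim F G + 1 <= covdim F GC)%N.
Proof.
move=> pW; have pW' := pmodule_ext pW; have [_ _ fW _ _] := pW.
have [bd irr fW' _ _] := pW'.
have [n' [m' [rV' [rW' [f0 [ff0 <-]]]]]] := covdim_attained (faithful_id fW').
have [f1 [ff1 lef1]] := faithful_covariant_transfer ff0 fW' fW'.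
have [f [a [ff lef hf]]] := multihomogenize bd irr bd ff1.
apply: leq_trans lef1; apply: leq_trans lef.
pose psi j := f (lshift 1 j).
have eM : {in G &, {morph (fun g : gT => (g, 1%g : 'Z_p)) : x y / (x * y)%g}}.
  by move=> x y _ _; congr pair; rewrite mulg1.
have eG g : g \in G -> (g, 1%g : 'Z_p) \in GC by move=> gG; rewrite inE gG inE.
have fE v : polymap f v = row_mx (polymap psi v) (mpoly_at (f (rshift n 0)) v)%:M.
  apply/rowP => j; case: (split_ordP j) => j' ->; rewrite ?row_mxEl ?row_mxEr !mxE //.
  by rewrite !ord1 eqxx.
have fpsi : faithful_covariant (pull_repr eM eG (ext_repr rW)) rW psi.
  have [eqf ffix] := ff; split=> [g v gG|g gG fixg].
    have := eqf _ v (eG g gG); rewrite !fE /= mul_row_ext.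
    by move/eq_row_mx => [].
  have [] : (g, 1%g : 'Z_p) = 1%g; last by [].
  apply: ffix => [|_ [v _ <-]]; first exact: eG.
  by rewrite fE /= mul_row_ext expr0 scale1r fixg //; exists v.
apply: leq_trans (leq_add (covdim_leq fpsi) (leqnn 1)) _.
(* The new block has a single coordinate, so its nonvanishing concerns the last component of [f]. *)
have {pW} [j0 bj0 fj0] := pmodule_neq0 pW' ff (rshift k 0).
have {}fj0 : f (rshift n 0) != 0.
  move: bj0 fj0; case: (split_ordP j0) => j ->; last by rewrite ord1.
  by rewrite ext_block_lshift => /eqP; rewrite eq_lrshift.
have [v [fv <-]] := jdim_generic psi fj0; set J := jacobian psi v.
have unitA := unitmx_mod1 (degree_mod pW' ff hf); set A := (\matrix_(_, _) _) in unitA.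
(* [c] combines the Euler identities of the source blocks so that the total degree is 1 on the new
   target block and 0 on the others; [y] is the corresponding tangent vector. *)
pose c := delta_mx 0 (rshift k 0) *m invmx A^T : 'rV_(k + 1).
have cA : c *m A^T = delta_mx 0 (rshift k 0) by rewrite mulmxKV // unitmx_tr.
pose y := \row_i (c 0 (ext_block b i) * v 0 i).
have yJ j : (y *m jacobian f v) 0 j =
    (c *m A^T) 0 (ext_block b j) * mpoly_at (f j) v.
  transitivity (\sum_x c 0 x * \sum_i (ext_block b i == x)%:R * v 0 i *
      mpoly_at (f j)^`M(i) v); last first.
    rewrite mxE mulr_suml; apply: eq_bigr => x _.
    by rewrite (euler v (hf j x)) !mxE mulrA.
  rewrite mxE; under [RHS]eq_bigr => x _ do rewrite mulr_sumr.
  rewrite exchange_big; apply: eq_bigr => i _ /=.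
  rewrite (bigD1 (ext_block b i)) //= eqxx mul1r big1 ?addr0 => [|x xi].
    by rewrite !mxE mulrA.
  by rewrite eq_sym (negPf xi) !mul0r mulr0.
have last_row : (row_mx 0 1%:M <= jacobian f v)%MS.
  apply/submxP; exists ((mpoly_at (f (rshift n 0)) v)^-1 *: y).
  apply/rowP => j; rewrite -scalemxAl [RHS]mxE yJ cA.
  case: (split_ordP j) => j' ->; rewrite ?row_mxEl ?row_mxEr !mxE.
    by rewrite ext_block_lshift eq_lrshift mul0r mulr0.
  by rewrite ext_block_rshift !ord1 !eqxx mul1r mulVf.
(* The last unit row lies in the row space, so the last column of the Jacobian can be cleared. *)
have first_rows : (row_mx J 0 <= jacobian f v)%MS.
  pose L : 'cV[F]_(n + 1) := \col_i jacobian f v i (rshift n 0).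
  have -> : row_mx J 0 = jacobian f v - L *m row_mx 0 1%:M.
    rewrite mul_mx_row mulmx0 mulmx1; apply/matrixP => i j.
    case: (split_ordP j) => j' ->.
      by rewrite row_mxEl [RHS]mxE [X in _ + X]mxE row_mxEl [X in _ - X]mxE subr0 !mxE.
    by rewrite row_mxEr [RHS]mxE [X in _ + X]mxE row_mxEr !mxE !ord1 subrr.
  by rewrite addmx_sub // eqmx_opp mulmx_sub.
apply: leq_trans (jdim_ge f v).
have <- : \rank (block_mx J 0 0 (1%:M : 'M[F]_1)) = (\rank J + 1)%N.
  by rewrite rank_diag_block_mx mxrank1.
by apply: mxrankS; rewrite col_mx_sub first_rows.
Qed.

Lemma covdim_ext n k (rW : mx_representation F G n) (b : 'I_n -> 'I_k) z :
  pmodule rW b z -> covdim F GC = (covdim F G + 1)%N.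
Proof.
move=> pW; have [_ _ /faithful_id/covdim_ext_leq le _ _] := pW.
by apply/eqP; rewrite eqn_leq le (covdim_ext_geq pW).
Qed.

End Extension.
End BlockModules.

(** * One factor Z/p when p does not divide the order of the center *)

Section CoprimeCenter.
Variables (F : numClosedFieldType) (p : nat) (omega : F).
Hypotheses (p_prime : prime p) (prim : p.-primitive_root omega).
Variables (gT : finGroupType) (G : {group gT}).
Hypotheses (pZ : ~~ (p %| #|'Z(G)%g|)%N) (G_neq1 : G != 1%G).
Local Notation GC := (setX_group G [set: 'Z_p]%G).

Lemma center_pelt g :
  g \in G -> (forall h, h \in G -> commute g h) -> (g ^+ p = 1)%g -> g = 1%g.
Proof.
move=> gG gC gp; apply/eqP; rewrite -order_eq1; apply: contraNT pZ => g1.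
have : (#[g]%g %| p)%N by rewrite order_dvdn gp.
move/(prime_nt_dvdP p_prime g1) => <-; apply: order_dvdG.
by apply/centerP.
Qed.

(** Finitely many proper subspaces, the kernels, do not cover the module. *)
Lemma generic_mulmx n m (I : finType) (P : pred I) (A : I -> 'M[F]_(n, m)) :
    (forall i, P i -> A i != 0) ->
  exists v : 'rV_n, forall i, P i -> v *m A i != 0.
Proof.
move=> A0.
have /choice[q qP] i : exists q, q != 0 /\
    forall v : 'rV_n, P i -> mpoly_at q v != 0 -> v *m A i != 0.
  have [/A0 Ai|_] := boolP (P i); last by exists 1; rewrite oner_eq0.
  have /matrix0Pn[k [j Aij]] := Ai; exists (affmap (A i) 0 j).
  have qE v : mpoly_at (affmap (A i) 0 j) v = (v *m A i) 0 j.
    by have /rowP/(_ j) := polymap_affmap (A i) 0 v; rewrite addr0 mxE.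
  split=> [|v _]; last by rewrite qE; apply: contraNneq => ->; rewrite mxE.
  apply: contraNneq Aij => q0; have := qE (delta_mx 0 k).
  by rewrite q0 mpoly_at0 -rowE mxE => <-.
have [v vP] := @mpoly_generic F n I P q (fun i _ => mpoly_at_neq0 (proj1 (qP i))).
by exists v => i Pi; apply: (proj2 (qP i)) => //; apply: vP.
Qed.

(* Otherwise invariants would not separate v from omega *: v. *)
Lemma invariant_coprime n (rV : mx_representation F G n) : mx_faithful rV ->
  exists q d, [/\ q != 0, whomog (fun=> 1%N) d q, ~~ (p %| d)%N &
    forall g v, g \in G -> mpoly_at q (v *m rV g) = mpoly_at q v].
Proof.
move=> fV.
have n_gt0 : (0 < n)%N.
  rewrite lt0n; apply: contraNneq G_neq1 => n0; subst n.
  apply/eqP/val_inj/trivgP/fintype.subsetP => g gG; apply/set1P.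
  by apply: (mx_faithful_eq1 fV gG); apply/matrixP => -[].
(* No element of G acts as the scalar [omega]: it would be central with p-th power 1, hence 1. *)
have [v vP] : exists v : 'rV_n, forall g, g \in G -> v *m (rV g - omega%:M) != 0.
  apply: generic_mulmx => g gG; rewrite subr_eq0; apply/eqP => rg.
  have g1 : g = 1%g.
    apply: center_pelt => // [h hG|].
      by apply: (mx_faithful_inj fV); rewrite ?groupM // !repr_mxM // rg scalar_mxC.
    apply: (mx_faithful_eq1 fV); first exact: groupX.
    by rewrite (repr_scalar_exp _ gG rg) (prim_expr_order prim).
  move: rg; rewrite g1 repr_mx1 => /matrixP/(_ (Ordinal n_gt0) (Ordinal n_gt0)).
  rewrite !mxE eqxx => w1; have := prim_order_dvd prim 1.
  rewrite expr1 -[omega]mulr1n -w1 eqxx dvdn1 => /eqP p1.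
  by have := prime_gt1 p_prime; rewrite p1.
pose S := [seq omega *: (v *m rV g) | g in G].
have /interpolate_point[q [qv qS]] : v \notin S.
  apply/fintype.imageP => -[g gG vg]; have /eqP := vP g^-1%g (groupVr gG); apply.
  rewrite mulmxBr mul_mx_scalar {1}vg -scalemxAl -mulmxA -repr_mxM ?groupV //.
  by rewrite mulgV repr_mx1 mulmx1 subrr.
(* An invariant polynomial with value 1 at v and 0 at omega *: v. *)
pose h := 1 - \prod_(g in G) (1 - psubst (affmap (rV g) 0) q).
have hE u : mpoly_at h u = 1 - \prod_(g in G) (1 - mpoly_at q (u *m rV g)).
  rewrite mpoly_atB mpoly_at1 mpoly_at_prod; congr (_ - _).
  by apply: eq_bigr => g _; rewrite mpoly_atB mpoly_at1 mpoly_at_mulmx.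
have hG g u : g \in G -> mpoly_at h (u *m rV g) = mpoly_at h u.
  move=> gG; rewrite !hE; congr (_ - _); rewrite [RHS](reindex_inj (mulgI g)) /=.
  apply: eq_big => [k|k kG]; first by rewrite groupMl.
  by rewrite repr_mxM // mulmxA.
have hv : mpoly_at h v = 1.
  by rewrite hE (bigD1 1%g) //= repr_mx1 mulmx1 qv subrr mul0r subr0.
have hwv : mpoly_at h (omega *: v) = 0.
  rewrite hE big1 ?subrr // => g gG; rewrite qS ?subr0 // -scalemxAl.
  by apply: (fintype.image_f (fun g => omega *: (v *m rV g))).
pose w (i : 'I_n) := 1%N.
have scaleE t u : wscale w t u = t *: u by apply/rowP => i; rewrite !mxE expr1.
have [d pd hd] : exists2 d, ~~ (p %| d)%N & mpoly_at (wpart w d h) v != 0.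
  (* If only degrees divisible by p contributed at v, then h would take the same value at v and at
     omega *: v. *)
  apply: contrapT => nex; have /eqP := oner_neq0 F; apply; rewrite -hv -hwv.
  rewrite -[v in LHS]scale1r -!scaleE !(mpoly_at_wscale_sum _ _ (leqnn (wsize w h))).
  apply: eq_bigr => d _; have [->|hd] := eqVneq (mpoly_at (wpart w d h) v) 0.
    by rewrite !mulr0.
  have [pd|pd] := boolP (p %| d)%N; last by case: nex; exists (d : nat).
  by rewrite expr1n; move: pd; rewrite (prim_order_dvd prim) => /eqP->.
exists (wpart w d h), d; split=> //; first by apply: contraNneq hd => ->; rewrite mpoly_at0.
  exact: whomog_wpart.
move=> g u gG; apply/eqP; rewrite -subr_eq0; apply/eqP.
pose k := (wsize w h + d.+1)%N.
apply: (@sum_exp_eq0 _ k (fun d => mpoly_at (wpart w d h) (u *m rV g) -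
  mpoly_at (wpart w d h) u)); last by rewrite /k addnS ltnS leq_addl.
move=> t t0; under eq_bigr do rewrite mulrBr.
rewrite sumrB -!(mpoly_at_wscale_sum _ _ (leq_addr _ _ : (wsize w h <= k)%N)).
by rewrite !scaleE scalemxAl hG // subrr.
Qed.

(* If (g, c) acts trivially on the image, then so do its commutators with G,
   whence g is central, and its p-th power, whence g ^+ p = 1. *)
Lemma faithful_from_factors n m (rV : mx_representation F GC n)
    (rW : mx_representation F GC m) f :
    equivariant rV rW f ->
    (forall g, g \in G -> (forall w, range (polymap f) w -> w *m rW (g, 1%g) = w) ->
      g = 1%g) ->
    (forall c, (forall w, range (polymap f) w -> w *m rW (1%g, c) = w) -> c = 1%g) ->
  faithful_covariant rV rW f.
Proof.
move=> eqf fG fC; split=> // -[g c] /setXP[gG _].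
pose fix_f x := x \in GC /\ forall w, range (polymap f) w -> w *m rW x = w.
move=> fixx; have {}fixx : fix_f (g, c) by split=> //; rewrite inE gG inE.
have fixM x y : fix_f x -> fix_f y -> fix_f (x * y)%g.
  move=> [xG fx] [yG fy]; split=> [|w fw]; first exact: groupM.
  by rewrite repr_mxM // mulmxA fx // fy.
have fixV x : fix_f x -> fix_f x^-1%g.
  move=> [xG fx]; split=> [|w fw]; first exact: groupVr.
  by rewrite -{1}(fx w fw) -mulmxA -repr_mxM ?groupV // mulgV repr_mx1 mulmx1.
have fixJ x y : fix_f x -> y \in GC -> fix_f (x ^ y)%g.
  move=> [xG fx] yG; split=> [|_ [v _ <-]]; first exact: groupJ.
  rewrite conjgE !repr_mxM ?groupM ?groupV // !mulmxA -eqf ?groupV //.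
  rewrite fx; last by exists (v *m rV y^-1%g).
  by rewrite eqf ?groupV // -mulmxA -repr_mxM ?groupV // mulVg repr_mx1 mulmx1.
have g1 : g = 1%g.
  apply: center_pelt => // [h hG|].
    have hGC : (h, 1%g : 'Z_p) \in GC by rewrite inE hG inE.
    have [_ fixR] := fixM _ _ (fixV _ fixx) (fixJ _ _ fixx hGC).
    apply/commgP; apply/eqP; apply: fG; first by rewrite groupR.
    move=> w fw; rewrite -[RHS](fixR w fw); congr (_ *m rW _).
    rewrite commgEl; congr pair; change (1 = c^-1 * c ^ 1)%g.
    by rewrite conjg1 mulVg.
  apply: fG; first exact: groupX.
  have fixX k : fix_f ((g, c) ^+ k)%g.
    elim: k => [|k IHk]; last by rewrite expgS; apply: fixM.
    by split=> [|w fw]; rewrite ?group1 // expg0 repr_mx1 mulmx1.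
  have [_ fixp] := fixX p; move=> w fw; rewrite -[RHS](fixp w fw).
  congr (_ *m rW _).
  have expE k : ((g, c) ^+ k = (g ^+ k, c ^+ k))%g.
    by elim: k => // k IHk; rewrite !expgS IHk.
  rewrite expE; congr pair; apply/esym/eqP; rewrite -order_dvdn.
  have /order_dvdG : c \in [set: 'Z_p]%G by rewrite inE.
  rewrite cardsT card_ord.
  by rewrite [X in (_ %| X)%N]Zp_cast ?prime_gt1.
rewrite g1 in fixx *; have [_ fixc] := fixx.
by congr pair; apply: fC.
Qed.

Section Twist.
Variables (n k : nat) (rW : mx_representation F G n) (b : 'I_n -> 'I_k).
Variable d : 'I_k -> nat.

(** On block c this is [rW] tensored with the d c-th power of the character of Z/p, so that a map of
    degree d c from a module with scalar action of Z/p becomes equivariant. *)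
Definition twist_mx (x : gT * 'Z_p) : 'M[F]_n :=
  \matrix_(i, j) (omega ^+ (x.2 * d (b j)) * rW x.1 i j).

Lemma mul_row_twist (v : 'rV[F]_n) x j :
  (v *m twist_mx x) 0 j = (omega ^+ x.2) ^+ d (b j) * (v *m rW x.1) 0 j.
Proof.
rewrite !mxE mulr_sumr; apply: eq_bigr => i _.
by rewrite mxE exprM mulrCA.
Qed.

Hypothesis bd : block_diag rW b.

Lemma twist_mx_repr : mx_repr GC twist_mx.
Proof.
split=> [|[g c] [h e] /setXP[gG _] /setXP[hG _]].
  by apply/matrixP => i j; rewrite mxE expr0 mul1r repr_mx1.
apply: eq_mulrow_mx => v; apply/rowP => j; rewrite mulmxA !mul_row_twist /=.
have -> : (v *m twist_mx (g, c) *m rW h) 0 j =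
    (((omega ^+ c) ^+ d (b j) *: (v *m rW g)) *m rW h) 0 j.
  apply: (block_diag_entry bd hG) => i bi.
  by rewrite mul_row_twist [RHS]mxE bi.
rewrite -scalemxAl [in RHS]mxE mulrA -mulmxA -repr_mxM //; congr (_ * _).
by rewrite -exprMn (omegaM p_prime prim) mulrC.
Qed.

Definition twist_repr := MxRepresentation twist_mx_repr.

End Twist.

(* Let a c be the degree of the component in block c, and p ^ e the largest
   power of p dividing all of them. Multiplying block c by q ^+ (a c / p ^ e),
   with q invariant of degree d, keeps the image inside that of f, because f is
   homogeneous and q u has a root of order p ^ e; it changes the degrees to
   (a c / p ^ e) * (p ^ e + d), not all divisible by p. *)
Lemma covdim_ext_coprime n k (rW : mx_representation F G n) (b : 'I_n -> 'I_k) :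
    block_diag rW b -> block_irr rW b -> mx_faithful rW ->
  (covdim F GC <= covdim F G)%N.
Proof.
move=> bd irr fW.
have [n0 [m0 [rV0 [rW0 [f0 [ff0 <-]]]]]] := covdim_attained (faithful_id fW).
have [f1 [ff1 lef1]] := faithful_covariant_transfer ff0 fW fW.
pose w (i : 'I_n) := 1%N.
have [|f [a0 [ff lef hf0 _]]] := homogenize (w := w) bd irr _ ff1.
  by move=> g i j _; rewrite eqxx.
apply: leq_trans lef1; apply: leq_trans lef.
have scaleE t u : wscale w t u = t *: u by apply/rowP => i; rewrite !mxE expr1.
have [eqf fixf] := ff.
pose nz c := [exists j, (b j == c) && (f j != 0)].
(* The degree found for a zero block is arbitrary; resetting it to 0 keeps it out of the minimum of
   the p-adic valuations below. *)
pose a c := if nz c then a0 c else 0%N.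
have hf t u j : mpoly_at (f j) (t *: u) = t ^+ a (b j) * mpoly_at (f j) u.
  have [->|fj] := eqVneq (f j) 0; first by rewrite !mpoly_at0 mulr0.
  rewrite -scaleE (mpoly_at_wscale _ _ (hf0 j)) /a /nz.
  by case: existsP => // -[]; exists j; rewrite eqxx.
(* If all degrees were 0, [f] would be constant and its only value fixed by G. *)
have [c0 ac0] : exists c, a c != 0%N.
  apply: contrapT => nex; case/eqP: G_neq1; apply/val_inj/trivgP/fintype.subsetP => g gG.
  apply/set1P; apply: fixf => // _ [v _ <-].
  have fconst u : polymap f u = polymap f 0.
    apply/rowP => j; rewrite !mxE -[0 in RHS](scale0r u) hf.
    have [->|aj] := eqVneq (a (b j)) 0%N; first by rewrite expr0 mul1r.
    by case: nex; exists (b j).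
  by rewrite -eqf // fconst [RHS]fconst.
have [c1 ac1 min1] : exists2 c, a c != 0%N &
    forall c', a c' != 0%N -> (logn p (a c) <= logn p (a c'))%N.
  by case: (@arg_minnP _ c0 (fun c => a c != 0%N) (fun c => logn p (a c)) ac0) => c;
     exists c.
pose e := logn p (a c1); pose a' c := (a c %/ p ^ e)%N.
have aE c : a c = (a' c * p ^ e)%N.
  rewrite divnK //; have [->|ac] := eqVneq (a c) 0%N; first by rewrite dvdn0.
  by rewrite pfactor_dvdn // ?min1 // lt0n.
have pa' : ~~ (p %| a' c1)%N.
  apply/negP => /(dvdn_mul (dvdnn (p ^ e))); rewrite mulnC -expnS mulnC -aE.
  by rewrite pfactor_dvdn // ?lt0n // ltnn.
have [q [d [q0 qd pd qG]]] : exists q d, [/\ q != 0, whomog w d q,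
    ~~ (p %| p ^ e + d)%N &
    forall g v, g \in G -> mpoly_at q (v *m rW g) = mpoly_at q v].
  (* For e = 0 the constant invariant 1 serves, as p ^ 0 + 0 = 1; for e > 0, p divides p ^ e and d
     itself must be prime to p. *)
  case: (posnP e) => [->|e_gt0].
    exists 1, 0%N; rewrite oner_eq0 expn0 addn0 dvdn1; split=> //.
    - move=> m; rewrite msupp1 inE => /eqP->; exact: wdeg0.
    - by apply/eqP => p1; have := prime_gt1 p_prime; rewrite p1.
    by move=> g v _; rewrite !mpoly_at1.
  have [q [d [q0 qd pd qG]]] := invariant_coprime fW.
  by exists q, d; split=> //; rewrite dvdn_addr // dvdn_exp.
pose f2 j := q ^+ a' (b j) * f j.
have f2E j u : mpoly_at (f2 j) u = mpoly_at q u ^+ a' (b j) * mpoly_at (f j) u.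
  by rewrite mpoly_atM mpoly_atXn.
have f2_range : range (polymap f2) `<=` range (polymap f).
  move=> _ [u _ <-]; exists ((p ^ e).-root (mpoly_at q u) *: u) => //.
  apply/rowP => j; rewrite !mxE f2E hf aE mulnC exprM rootCK //.
  by rewrite expn_gt0 prime_gt0.
apply: (@leq_trans (jdim f2)); last first.
  by apply: jdim_closure => x /f2_range; apply: sub_zariski_closure.
pose deg c := (a' c * (p ^ e + d))%N.
have f2_hom t u j : mpoly_at (f2 j) (t *: u) = t ^+ deg (b j) * mpoly_at (f2 j) u.
  rewrite !f2E hf -scaleE (mpoly_at_wscale _ _ qd) exprMn -exprM /deg mulnDr exprD.
  by rewrite -aE [(d * _)%N]mulnC mulrACA [_ ^+ a (b j) * _]mulrC.
have f2_G g u j : g \in G -> mpoly_at (f2 j) (u *m rW g) = (polymap f2 u *m rW g) 0 j.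
  move=> gG; rewrite f2E qG //; have /rowP/(_ j) := eqf g u gG; rewrite mxE => ->.
  rewrite (@block_diag_entry _ _ _ _ _ rW b (polymap f2 u) (mpoly_at q u ^+ a' (b j) *: polymap f u)) //.
    by rewrite -scalemxAl [RHS]mxE.
  by move=> i bi; rewrite !mxE f2E bi.
have bd0 : block_diag rW (fun=> @ord0 0) by move=> g i j _; rewrite eqxx.
(* Z/p acts by scalars on the source and through the degrees of [f2] on the target. *)
apply: (@covdim_leq _ _ _ _ _ (twist_repr (fun=> 1%N) bd0) (twist_repr deg bd)).
apply: faithful_from_factors.
- move=> [g c] u /setXP[gG _]; apply/rowP => j; rewrite mul_row_twist mxE /=.
  have -> : u *m twist_mx rW (fun=> @ord0 0) (fun=> 1%N) (g, c) = omega ^+ c *: (u *m rW g).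
    by apply/rowP => i; rewrite mul_row_twist expr1 [RHS]mxE.
  by rewrite f2_hom f2_G.
- move=> g gG fixg.
  (* Where q is nonzero, [f2] differs from [f] by a nonzero factor on each block, so fixing the
     value of [f2] at u means fixing that of [f]. *)
  have [u [qu stabu]] := faithful_generic fixf q0; apply: stabu => //.
  apply/rowP => j; have /rowP/(_ j) := fixg (polymap f2 u) (ex_intro2 _ _ u I erefl).
  rewrite mul_row_twist expr0 expr1n mul1r /= -f2_G // f2E qG // [RHS]mxE f2E.
  move/(mulfI (expf_neq0 _ qu)) => fix_j; rewrite [RHS]mxE -fix_j.
  by have /rowP/(_ j) := eqf g u gG; rewrite mxE => ->.
move=> c fixc; apply: (omega_eq1 p_prime prim).
(* The degree of [f2] on block c1 is prime to p, so a nonzero component there detects every element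
   of Z/p. *)
have [j /andP[/eqP bj fj]] : exists j, (b j == c1) && (f j != 0).
  by move: ac1; rewrite /a; case: ifP => // /existsP.
have [u] := mpoly_at_neq0 (mulf_neq0 (expf_neq0 (a' (b j)) q0) fj) => f2u.
have /rowP/(_ j) := fixc (polymap f2 u) (ex_intro2 _ _ u I erefl).
rewrite mul_row_twist /= repr_mx1 mulmx1 mxE -[in RHS](mul1r (mpoly_at _ _)).
move/(mulIf f2u)/eqP; rewrite -exprM -(prim_order_dvd prim) bj /deg.
rewrite !Euclid_dvdM // (negPf pa') (negPf pd) !orbF.
by rewrite (prim_order_dvd prim) => /eqP.
Qed.

End CoprimeCenter.

(** * Irreducible modules and products of groups *)

Section Irreducible.
Variables (F : numClosedFieldType) (gT : finGroupType) (G : {group gT}).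
Variables (n : nat) (rG : mx_representation F G n).
Hypothesis irrG : mx_irreducible rG.

Lemma irr_span (w u : 'rV[F]_n) : w != 0 ->
  exists c : gT -> F, u = \sum_(h in G) c h *: (w *m rG h).
Proof.
move=> w0; have [_ _ /(_ (cyclic_mx rG w))] := irrG.
rewrite cyclic_mx_module cyclic_mx_eq0 submx1 => /(_ isT isT w0) full.
have /cyclic_mxP[A /envelop_mxP[c ->] ->] := submx_trans (submx1 u) full.
exists c; rewrite mulmx_sumr; apply: eq_bigr => h _.
by rewrite -scalemxAr.
Qed.

Lemma central_scalar g : g \in 'Z(G)%g -> exists a, rG g = a%:M.
Proof.
move=> /centerP[gG gC]; apply/is_scalar_mxP.
apply: (@mx_abs_irr_cent_scalar _ _ G _ rG).
  exact: (group_closure_closed_field irrG).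
by apply/centgmxP => h hG; rewrite -!repr_mxM // gC.
Qed.

Lemma irr_dim_gt0 : (0 < n)%N.
Proof.
rewrite lt0n; apply: contraPneq irrG => n0 [_ /eqP[]]; subst n.
by apply/matrixP => -[].
Qed.

End Irreducible.

Section RootsOfUnity.
Variables (F : numClosedFieldType) (p : nat).
Hypothesis p_prime : prime p.

Lemma prim_root_prime (a : F) : a ^+ p = 1 -> a != 1 -> p.-primitive_root a.
Proof.
move=> ap a1; have [m pm mp] := prim_order_exists (prime_gt0 p_prime) ap.
have /primeP[_ /(_ m mp)/orP[/eqP m1|/eqP <-//]] := p_prime.
by move: a1; rewrite -(prim_expr_order pm) m1 expr1 eqxx.
Qed.

Lemma prime_prim_root_exists : exists a : F, p.-primitive_root a.
Proof.
(* A root of 1 + X + ... + X^(p-1): a p-th root of unity, and not 1 because p is nonzero in F. *)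
pose P : {poly F} := \poly_(i < p) 1.
have sP : size P = p.
  rewrite /P; case: (p) (prime_gt0 p_prime) => // q _.
  by rewrite size_poly_eq // oner_eq0.
have /closed_rootP[a /rootP Pa] : size P != 1%N.
  by rewrite sP; apply/eqP => p1; have := prime_gt1 p_prime; rewrite p1.
have aE : \sum_(i < p) a ^+ i = 0.
  by rewrite -[RHS]Pa /P horner_poly; apply: eq_bigr => i _; rewrite mul1r.
exists a; apply: prim_root_prime.
  by apply/eqP; rewrite -subr_eq0 subrX1 aE mulr0.
apply/eqP => a1; move/eqP: aE; rewrite a1.
under eq_bigr do rewrite expr1n.
by rewrite sumr_const card_ord pnatr_eq0 -leqn0 leqNgt prime_gt0.
Qed.

(** By Schur's lemma a central element of order p is a scalar of order p; passing to a power makes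
    that scalar the prescribed [omega], the same for all factors of a product. *)
Lemma central_element (omega : F) (gT : finGroupType) (G : {group gT}) n
    (rG : mx_representation F G n) :
    p.-primitive_root omega -> mx_irreducible rG -> mx_faithful rG ->
    (p %| #|'Z(G)%g|)%N ->
  exists2 z, z \in G & rG z = omega%:M.
Proof.
move=> prim irrG fG /(Cauchy p_prime)[z zZ oz].
have /centerP[zG _] := zZ; have [a rz] := central_scalar irrG zZ.
have n_gt0 := irr_dim_gt0 irrG.
have rzk k := repr_scalar_exp k zG rz.
have scalar1 c : c%:M = 1%:M :> 'M[F]_n -> c = 1.
  by move/matrixP/(_ (Ordinal n_gt0) (Ordinal n_gt0)); rewrite !mxE eqxx.
have pa : p.-primitive_root a.
  apply: prim_root_prime; first by apply: scalar1; rewrite -rzk -oz expg_order repr_mx1.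
  apply/eqP => a1; have z1 : z = 1%g by apply: (mx_faithful_eq1 fG zG); rewrite rz a1.
  by move: oz; rewrite z1 order1 => p1; have := prime_gt1 p_prime; rewrite -p1.
have [i wE] := prim_rootP pa (prim_expr_order prim).
by exists (z ^+ i)%g; rewrite ?groupX // rzk -wE.
Qed.

End RootsOfUnity.

Section ProductModule.
Variables (F : numClosedFieldType) (n : nat) (gT : 'I_n -> finGroupType).
Variables (G : forall i, {group gT i}) (d : 'I_n -> nat).
Variable rG : forall i, mx_representation F (G i) (d i).
Local Notation GG := (setXn_group G).

Definition prodn_mx (x : {dffun forall i, gT i}) : 'M[F]_(\sum_i d i) :=
  \mxdiag_i rG i (x i).

Lemma mul_row_prodn (v : 'rV[F]_(\sum_i d i)) x :
  v *m prodn_mx x = \mxrow_i (submxrow v i *m rG i (x i)).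
Proof. by rewrite -{1}(submxrowK v) mul_mxrow_mxdiag. Qed.

Lemma prodn_mx_repr : mx_repr GG prodn_mx.
Proof.
split=> [|x y /setXnP xG /setXnP yG]; apply: eq_mulrow_mx => v.
  rewrite mul_row_prodn mulmx1 -[RHS]submxrowK; apply: eq_mxrow => i.
  by rewrite oneg_ffun repr_mx1 mulmx1.
rewrite mulmxA !mul_row_prodn; apply: eq_mxrow => i.
by rewrite mxrowK mulg_ffun (repr_mxM _ (xG i) (yG i)) mulmxA.
Qed.

Definition prodn_repr := MxRepresentation prodn_mx_repr.

Let b : 'I_(\sum_i d i) -> 'I_n := tagnat.sig1.

Lemma mul_row_prodn_entry (v : 'rV[F]_(\sum_i d i)) x k :
  (v *m prodn_mx x) 0 k =
    (submxrow v (tagnat.sig1 k) *m rG _ (x (tagnat.sig1 k))) 0 (tagnat.sig2 k).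
Proof. by rewrite mul_row_prodn mxE. Qed.

Lemma prodn_block_diag : block_diag prodn_repr b.
Proof.
move=> x k l _ kl; have -> : prodn_repr x k l = ((delta_mx 0 k : 'rV[F]_(\sum_i d i)) *m prodn_mx x) 0 l.
  by rewrite -rowE [RHS]mxE.
rewrite mul_row_prodn_entry; have -> : submxrow (delta_mx 0 k : 'rV[F]_(\sum_i d i)) (tagnat.sig1 l) = 0 :> 'rV[F]_(d (tagnat.sig1 l)).
  apply/rowP => j; rewrite !mxE eqxx /=; case: eqP => // e.
  by case/eqP: kl; rewrite /b -e tagnat.Rank1K.
by rewrite mul0mx mxE.
Qed.

Hypothesis irrG : forall i, mx_irreducible (rG i).

Lemma prodn_block_irr : block_irr prodn_repr b.
Proof.
move=> w u k0 w0; set i := b k0.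
have wi : submxrow w i != 0.
  apply: contraNneq w0 => /rowP/(_ (tagnat.sig2 k0)); rewrite !mxE.
  by rewrite tagnat.sig2K => ->.
have [c cE] := irr_span (irrG i) (submxrow u i) wi.
(* Only elements trivial outside factor i are used; they form a copy of [G i], which is irreducible
   on block i. *)
exists (fun x : {dffun forall i, gT i} => if x == dfung1 (x i) then c (x i) else 0) => k bk.
transitivity (\sum_(h in G i) c h * (w *m prodn_mx (dfung1 h)) 0 k); last first.
  rewrite [RHS](bigID (fun x : {dffun forall i, gT i} => x == dfung1 (x i))) /= [X in _ = _ + X]big1 => [|x].
    rewrite addr0 (reindex_onto (@dfung1 _ gT i) (fun x => x i)) /=.
      apply: eq_big => h.
        rewrite dfung1_id !eqxx !andbT; apply/idP/setXnP => [hG j|/(_ i)].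
          have [<-|ij] := eqVneq i j; first by rewrite dfung1_id.
          by rewrite dfung1_dflt.
        by rewrite dfung1_id.
      by move=> _; rewrite dfung1_id eqxx.
    by move=> x /andP[_ /eqP].
  by case/andP=> _ /negPf->; rewrite mul0r.
under [RHS]eq_bigr do rewrite mul_row_prodn_entry.
rewrite -{1}[u]submxrowK [LHS]mxE; move: (tagnat.sig2 k); rewrite -/(b k) bk => l.
rewrite cE summxE; apply: eq_bigr => h _.
by rewrite mxE dfung1_id.
Qed.

Hypothesis fG : forall i, mx_faithful (rG i).

Lemma prodn_faithful : mx_faithful prodn_repr.
Proof.
apply: mx_faithfulP => x /setXnP xG rx; apply/ffunP => i; rewrite oneg_ffun.
apply: (mx_faithful_eq1 (fG i) (xG i)).
apply: eq_mulrow_mx => v; rewrite mulmx1.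
(* The vector v placed in block i; [conform_mx] transports it along the equality j = i of
   indices. *)
pose v' := \mxrow_j (if j == i then conform_mx 0 v else 0 : 'rV[F]_(d j)).
have := congr1 (fun A => submxrow (v' *m A) i) rx; rewrite /= mulmx1 mul_row_prodn.
by rewrite !mxrowK eqxx conform_mx_id.
Qed.

Lemma prodn_pmodule (omega : F) (z : forall i, gT i) :
    (forall i, z i \in G i) -> (forall i, rG i (z i) = omega%:M) ->
  pmodule omega prodn_repr b (fun i => dfung1 (z i)).
Proof.
move=> zG rz; split.
- exact: prodn_block_diag.
- exact: prodn_block_irr.
- exact: prodn_faithful.
- move=> i; have d_gt0 := irr_dim_gt0 (irrG i).
  by exists (tagnat.Rank i (Ordinal d_gt0)); rewrite /b tagnat.Rank1K.
move=> i; split.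
  apply/setXnP => j; have [<-|ij] := eqVneq i j; first by rewrite dfung1_id zG.
  by rewrite dfung1_dflt // group1.
apply: eq_mulrow_mx => v; apply/rowP => k.
rewrite mul_row_prodn_entry mul_mx_diag [RHS]mxE -{2}[v]submxrowK [X in X * _]mxE.
move: (tagnat.sig2 k); rewrite /b mxE; have [->|ki] := eqVneq (tagnat.sig1 k) i => l.
  by rewrite dfung1_id rz mul_mx_scalar mxE mulrC.
by rewrite dfung1_dflt 1?eq_sym // repr_mx1 mulmx1 mulr1.
Qed.

End ProductModule.

(** * From one factor Z/p to (Z/p)^m *)

Section Invariance.
Variable F : numClosedFieldType.

Lemma exists_faithful_covariant (gT : finGroupType) (G : {group gT}) :
  exists n (rV : mx_representation F G n) f, faithful_covariant rV rV f.
Proof.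
exists #|G|, (regular_repr F G), (fun i => 'X_i).
exact: faithful_id (regular_mx_faithful F G).
Qed.

Lemma covdim_mono (gT hT : finGroupType) (G : {group gT}) (H : {group hT}) h :
    {in G &, {morph h : x y / (x * y)%g}} -> (forall g, g \in G -> h g \in H) ->
    (forall g, g \in G -> h g = 1%g -> g = 1%g) ->
  (covdim F G <= covdim F H)%N.
Proof.
move=> hM hG inj_h; have [n [rV [f ff]]] := exists_faithful_covariant H.
exact: (covdim_pull hM hG ff inj_h).
Qed.

Variables (p : nat) (omega : F).
Hypotheses (p_prime : prime p) (prim : p.-primitive_root omega).

Lemma covdim_setX_rV0 (gT : finGroupType) (G : {group gT}) :
  covdim F (setX_group G [set: 'rV['Z_p]_0]%G) = covdim F G.
Proof.
apply/eqP; rewrite eqn_leq; apply/andP; split.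
  apply: (@covdim_mono _ _ _ _ (fun x => x.1)) => //.
    by move=> [g r] /setXP[].
  by move=> [g r] _ /= ->; congr pair; rewrite !thinmx0.
apply: (@covdim_mono _ _ _ _ (fun g => (g, 1%g))).
- by move=> x y _ _; congr pair; rewrite mulg1.
- by move=> g gG; rewrite inE gG inE.
by move=> g _ [].
Qed.

Lemma covdim_setX_rVS (gT : finGroupType) (G : {group gT}) m :
  covdim F (setX_group G [set: 'rV['Z_p]_m.+1]%G) =
  covdim F (setX_group (setX_group G [set: 'Z_p]%G) [set: 'rV['Z_p]_m]%G).
Proof.
apply/eqP; rewrite eqn_leq; apply/andP; split.
  pose h (x : gT * 'rV['Z_p]_m.+1) : (gT * 'Z_p) * 'rV['Z_p]_m :=
    (x.1, x.2 0 ord0, \row_j x.2 0 (lift ord0 j)).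
  apply: (@covdim_mono _ _ _ _ h).
  - move=> [g r] [g' r'] _ _; rewrite /h /=; congr (_, _, _); first by rewrite mxE.
    by apply/rowP => j; rewrite !mxE.
  - by move=> [g r] /setXP[gG _]; rewrite !inE gG.
  move=> [g r] _; rewrite /h /= => -[-> r0 /rowP rS]; congr pair.
  apply/rowP => j; case: (unliftP ord0 j) => [i|] ->; last by rewrite r0 mxE.
  by have := rS i; rewrite !mxE.
pose h (x : (gT * 'Z_p) * 'rV['Z_p]_m) : gT * 'rV['Z_p]_m.+1 :=
  (x.1.1, \row_j if unlift ord0 j is Some i then x.2 0 i else x.1.2).
apply: (@covdim_mono _ _ _ _ h).
- move=> [[g c] r] [[g' c'] r'] _ _; rewrite /h /=; congr pair.
  by apply/rowP => j; rewrite !mxE; case: unlift => [i|] //; rewrite mxE.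
- by move=> [[g c] r] /setXP[/setXP[gG _] _]; rewrite !inE gG.
move=> [[g c] r] _; rewrite /h /= => -[-> /rowP rE]; congr (_, _, _).
  by have := rE ord0; rewrite !mxE unlift_none.
by apply/rowP => j; have := rE (lift ord0 j); rewrite !mxE liftK.
Qed.

Lemma covdim_setX_rV m (gT : finGroupType) (G : {group gT}) :
  has_pmodule omega G ->
  covdim F (setX_group G [set: 'rV['Z_p]_m]%G) = (covdim F G + m)%N.
Proof.
elim: m gT G => [|m IHm] gT G pG; first by rewrite covdim_setX_rV0 addn0.
have [n [k [rW [b [z pW]]]]] := pG.
rewrite covdim_setX_rVS IHm.
  by rewrite (covdim_ext p_prime prim pW) -addnA add1n.
exists (n + 1)%N, (k + 1)%N, (ext_repr p_prime prim rW), (ext_block b), (ext_center p z).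
exact: pmodule_ext.
Qed.

Lemma has_pmodule_prod n (gT : 'I_n -> finGroupType) (G : forall i, {group gT i}) :
    (forall i, faithful_group F (G i)) -> (forall i, (p %| #|'Z(G i)%g|)%N) ->
  has_pmodule omega (setXn_group G).
Proof.
move=> fG pZ.
have ex i : exists d (rG : mx_representation F (G i) d) z, [/\ mx_irreducible rG,
    mx_faithful rG, z \in G i & rG z = omega%:M].
  have [d [rG [irrG ffG]]] := fG i; exists d, rG.
  by have [z zG rz] := central_element p_prime prim irrG ffG (pZ i); exists z.
(* The type of the representation depends on the chosen dimension, so the choices are made one after
   the other. *)
pose d i := sval (cid (ex i)).
pose rG i : mx_representation F (G i) (d i) := sval (cid (svalP (cid (ex i)))).
pose z i := sval (cid (svalP (cid (svalP (cid (ex i)))))).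
have zP i : [/\ mx_irreducible (rG i), mx_faithful (rG i), z i \in G i
    & rG i (z i) = omega%:M] := svalP (cid (svalP (cid (svalP (cid (ex i)))))).
exists (\sum_i d i)%N, n, (prodn_repr rG), (@tagnat.sig1 _ d), (fun i => dfung1 (z i)).
by apply: prodn_pmodule => i; have [] := zP i.
Qed.

Definition has_irr_blocks (gT : finGroupType) (G : {group gT}) :=
  exists n k (rW : mx_representation F G n) (b : 'I_n -> 'I_k),
    [/\ block_diag rW b, block_irr rW b & mx_faithful rW].

Lemma has_irr_blocks_prod n (gT : 'I_n -> finGroupType) (G : forall i, {group gT i}) :
  (forall i, faithful_group F (G i)) -> has_irr_blocks (setXn_group G).
Proof.
move=> fG; pose d i := sval (cid (fG i)).
pose rG i : mx_representation F (G i) (d i) := sval (cid (svalP (cid (fG i)))).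
have rP i : mx_irreducible (rG i) /\ mx_faithful (rG i) :=
  svalP (cid (svalP (cid (fG i)))).
exists (\sum_i d i)%N, n, (prodn_repr rG), (@tagnat.sig1 _ d); split.
- exact: prodn_block_diag.
- by apply: prodn_block_irr => i; have [] := rP i.
by apply: prodn_faithful => i; have [] := rP i.
Qed.

Lemma irr_single_block (gT : finGroupType) (G : {group gT}) d
    (rG : mx_representation F G d) :
  mx_irreducible rG -> block_irr rG (fun=> @ord0 0).
Proof.
move=> irrG w u j0 w0; have /(irr_span irrG u)[c ->] : w != 0.
  by apply: contraNneq w0 => ->; rewrite mxE.
exists c => j _; rewrite summxE; apply: eq_bigr => h _.
by rewrite [LHS]mxE.
Qed.

Lemma has_irr_blocks1 (gT : finGroupType) (G : {group gT}) :
  faithful_group F G -> has_irr_blocks G.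
Proof.
move=> [d [rG [irrG fG]]]; exists d, 1%N, rG, (fun=> ord0); split=> //.
exact: irr_single_block.
Qed.

Lemma covdim_setX_Zp_coprime (gT : finGroupType) (G : {group gT}) :
    G != 1%G -> ~~ (p %| #|'Z(G)%g|)%N -> has_irr_blocks G ->
  covdim F (setX_group G [set: 'Z_p]%G) = covdim F G.
Proof.
move=> G1 pZ [n [k [rW [b [bd irr fW]]]]]; apply/eqP; rewrite eqn_leq.
rewrite (covdim_ext_coprime p_prime prim pZ G1 bd irr fW) /=.
apply: (@covdim_mono _ _ _ _ (fun g => (g, 1%g))).
- by move=> x y _ _; congr pair; rewrite mulg1.
- by move=> g gG; rewrite inE gG inE.
by move=> g _ [].
Qed.

Lemma has_pmodule1 (gT : finGroupType) (G : {group gT}) :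
    faithful_group F G -> (p %| #|'Z(G)%g|)%N ->
  has_pmodule omega G.
Proof.
move=> [d [rG [irrG fG]]] pZ.
have [z zG rz] := central_element p_prime prim irrG fG pZ.
exists d, 1%N, rG, (fun=> ord0), (fun=> z); split=> //.
- exact: irr_single_block.
- by move=> x; exists (Ordinal (irr_dim_gt0 irrG)); rewrite !ord1.
move=> x; split=> //; rewrite rz; apply/matrixP => i j.
by rewrite (ord1 x) !mxE.
Qed.

(** The faithful irreducible module of G, with Z/p acting through the scalars [omega]: it stays
    faithful because no nontrivial element of the center has p-th power 1, and (1, [Zp1]) is the
    element required by its single block. *)
Lemma has_pmodule_ext (gT : finGroupType) (G : {group gT}) :
    faithful_group F G -> ~~ (p %| #|'Z(G)%g|)%N ->
  has_pmodule omega (setX_group G [set: 'Z_p]%G).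
Proof.
move=> [d [rG [irrG fG]]] pZ.
have bd : block_diag rG (fun=> @ord0 0) by move=> g i j _; rewrite eqxx.
pose rW := twist_repr p_prime prim (fun=> 1%N) bd.
have n_gt0 := irr_dim_gt0 irrG; pose j0 := Ordinal n_gt0.
have rWE (v : 'rV_d) g c : v *m rW (g, c) = omega ^+ c *: (v *m rG g).
  by apply/rowP => j; rewrite mul_row_twist expr1 [RHS]mxE.
exists d, 1%N, rW, (fun=> ord0), (fun=> (1%g, Zp1)); split.
- by move=> g i j _; rewrite eqxx.
- move=> w u j1 w0; have [c cE] := irr_single_block irrG u w0.
  exists (fun x => if x.2 == 1%g then c x.1 else 0) => j _; rewrite cE //.
  rewrite (eq_bigl (fun x : gT * 'Z_p => (x.1 \in G) && true)) => [|x]; last first.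
    by rewrite inE inE.
  rewrite -(pair_big (mem G) xpredT (fun g (e : 'Z_p) =>
    (if e == 1%g then c g else 0) * (w *m rW (g, e)) 0 j)) /=.
  apply: eq_bigr => g _; rewrite (bigD1 1%g) //= big1 ?addr0 => [|e].
    by rewrite rWE expr0 scale1r.
  by move=> /negPf->; rewrite mul0r.
- apply: mx_faithfulP => -[g c] /setXP[gG _] rx.
  have rg : omega ^+ c *: rG g = 1%:M.
    by apply: eq_mulrow_mx => v; rewrite -scalemxAr -rWE rx.
  have wc0 : omega ^+ c != 0 by rewrite expf_neq0 // (prim_root_eq0 prim) -lt0n prime_gt0.
  (* An element (g, c) acting trivially makes g a scalar whose p-th power is 1. *)
  have {}rg : rG g = ((omega ^+ c)^-1)%:M.
    by rewrite -[LHS]scale1r -(mulVf wc0) -scalerA rg scalemx1.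
  have g1 : g = 1%g.
    apply: (center_pelt p_prime pZ) => // [h hG|].
      by apply: (mx_faithful_inj fG); rewrite ?groupM // !repr_mxM // rg scalar_mxC.
    apply: (mx_faithful_eq1 fG); first exact: groupX.
    rewrite (repr_scalar_exp _ gG rg) exprVn -exprM mulnC exprM.
    by rewrite (prim_expr_order prim) expr1n invr1.
  move: rg; rewrite g1 repr_mx1 => /matrixP/(_ j0 j0); rewrite !mxE eqxx => /esym/eqP.
  by rewrite invr_eq1 => /eqP/(omega_eq1 p_prime prim)->.
- by move=> x; exists j0; rewrite !ord1.
move=> x; split; first by rewrite !inE group1.
apply: eq_mulrow_mx => v; rewrite rWE repr_mx1 mulmx1; apply/rowP => j.
rewrite mul_mx_diag !mxE (ord1 x) mulrC; congr (_ * _).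
Qed.

End Invariance.

Theorem corollary4p4 (R : realType) (p : nat) (p_prime : prime p) :
  (forall (n : nat) (gT : 'I_n -> finGroupType) (G : forall i : 'I_n, {group gT i}),
     (0 < n)%N ->
     (forall i, G i != 1%G) ->
     (forall i, faithful_group R[i] (G i)) ->
     (coprime p #|('Z(setXn G))%g| ->
        covdim R[i] (setX_group (setXn_group G) [set: 'Z_p]%G)
        = covdim R[i] (setXn_group G))
     /\
     ((forall i, (p %| #|('Z(G i))%g|)%N) ->
        forall m : nat, (1 <= m)%N ->
        covdim R[i] (setX_group (setXn_group G) [set: 'rV['Z_p]_m]%G)
        = (covdim R[i] (setXn_group G) + m)%N))
  /\
  (forall (hT : finGroupType) (H : {group hT}) (m : nat),
     H != 1%G ->
     faithful_group R[i] H ->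
     (1 <= m)%N ->
     ((p %| #|('Z(H))%g|)%N ->
        covdim R[i] (setX_group H [set: 'rV['Z_p]_m]%G)
        = (covdim R[i] H + m)%N)
     /\
     (~~ (p %| #|('Z(H))%g|)%N ->
        covdim R[i] (setX_group H [set: 'rV['Z_p]_m]%G)
        = (covdim R[i] H + (m - 1))%N)).
Proof.
have [omega prim] := prime_prim_root_exists R[i] p_prime.
split=> [n gT G n_gt0 G1 fG|hT H m H1 fH m_gt0].
  split=> [pZ|pZ m _]; last first.
    by apply: (covdim_setX_rV p_prime prim); exact: (has_pmodule_prod p_prime prim).
  apply: (covdim_setX_Zp_coprime p_prime prim); last exact: has_irr_blocks_prod.
    (* The product is nontrivial because n > 0 provides a nontrivial factor. *)
    apply: contraNneq (G1 (Ordinal n_gt0)) => GG1; apply/eqP/val_inj/trivgP.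
    apply/fintype.subsetP => g gG; apply/set1P.
    have : dfung1 g \in setXn_group G.
      apply/setXnP => j; have [<-|ij] := eqVneq (Ordinal n_gt0) j.
        by rewrite dfung1_id.
      by rewrite dfung1_dflt // group1.
    rewrite GG1 => /set1P/ffunP/(_ (Ordinal n_gt0)).
    by rewrite dfung1_id oneg_ffun.
  by rewrite -prime_coprime.
split=> pZ; first exact/(covdim_setX_rV p_prime prim)/(has_pmodule1 p_prime prim fH).
(* The first Z/p is absorbed by (1); the resulting group has a block module, so each remaining
   factor adds one. *)
case: m m_gt0 => // m _; rewrite covdim_setX_rVS subn1.
rewrite (covdim_setX_rV p_prime prim); last exact: has_pmodule_ext.
by rewrite (covdim_setX_Zp_coprime p_prime prim H1 pZ) //; apply: has_irr_blocks1.
Qed.
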